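(* For every sufficiently small constant $\varepsilon^0>0$ there exist $\varepsilon^*$ with $0<\varepsilon^*<\varepsilon^0$ and a finite point set $S\subset\mathbb{R}^2$ such that every set $T\subset\mathbb{R}^2$ (not necessarily contained in $S$) which contains a point of every line containing at least $\varepsilon^*|S|$ points of $S$ (i.e., every weak $\varepsilon^*$-net of $S$ for lines) satisfies $$|T|\ge \frac{1}{10\varepsilon^*}\Big(\log\log\frac{1}{\varepsilon^*}\Big)^{1/10}.$$
   Context: Logarithms are to base 2. For a finite point set $S$ in the plane, a set $T\subset\mathbb{R}^2$ is a weak $\varepsilon$-net (with respect to lines) if every line $\ell$ with $|\ell\cap S|\ge\varepsilon|S|$ contains a point of $T$. *)

(* Defs.v *)
From Stdlib Require Import Reals List.
Import ListNotations.
Open Scope R_scope.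

Definition point : Type := (R * R)%type.

Record line : Type := mkLine { la : R; lb : R; lc : R; lnd : ~ (la = 0 /\ lb = 0) }.

Definition on_line (l : line) (p : point) : Prop :=
  la l * fst p + lb l * snd p = lc l.

Definition on_line_dec (l : line) (p : point) : bool :=
  if Req_EM_T (la l * fst p + lb l * snd p) (lc l) then true else false.

(* |l ∩ S| for a duplicate-free list S *)
Definition count_on_line (l : line) (S : list point) : nat :=
  length (filter (on_line_dec l) S).

Definition weak_eps_net (eps : R) (S T : list point) : Prop :=
  forall l : line, INR (count_on_line l S) >= eps * INR (length S) ->
    exists t, In t T /\ on_line l t.

Definition log2 (x : R) : R := ln x / ln 2.

(* Main.v *)
(** The points of [S] are sampled from the strip [{(s, v) | s < q, v < M}], whose lines
    [y = a + b x] ([a < N], [b < H]) all carry [q] points, where [q] is a large multiple of [k].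
    Any subset of the strip of positive density therefore contains [k] points of a positive
    proportion of the lines.

    Fix the set [U] of sampled indices that avoid [T].  If [U] spans few collinear [k]-tuples,
    there is a largest [j] for which it spans many collinear [j]-tuples; averaging yields a
    group of [j] blocks of the sample whose collinear [j]-tuples determine a set [W] of positive
    density that is almost missed by [U].  Deleting [W] and iterating leaves a tiny region that
    depends on a bounded number of blocks and yet contains a quarter of the remaining,
    independent, sample points.  This is so unlikely that a union bound over all [2 ^ n] sets
    [U] applies: every half of the sample spans many collinear [k]-tuples.

    A point [t] of [T] hits at most two of these rich lines unless three of them are concurrent
    at [t].  Concurrent triples of lines are counted by a gcd sum, and since the three lines
    share no sample point of [U], the expected number of rich triples is negligible.  So [T]
    misses a rich line as soon as [4 |T| <= n], while [n] is at most doubly exponential in [k]. *)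

(* The net may spoil an arbitrary half of the sample, so the claim about halves must fail with
   probability well below 2^(-n), far beyond a moment bound. Moments therefore control only
   properties of the whole sample ([tame]), which serve every half at once. The exponentially small
   probability comes from many independent coordinates all falling into one region of density at
   most 1/De. Blocks supply the independence: a round of deletion reads the sample only on fewer
   than k blocks, and all rounds together touch at most an eighth of the indices.

   The size of n is dictated by the thresholds. [th j] is 2^(-b j) times the typical number of
   collinear j-tuples, and one level costs b (j+1) >= 3 b j + O(log k). Hence b k is exponential in
   k, the number of rounds is 2^(O(b k)), and the sample must be doubly exponential. In the final
   choice log log n lies between 4 k and 5 k, which is why k points per line translate into a power
   of log log (1/eps). *)
Require Import Defs.
From Stdlib Require Import Reals List FinFun Lra.

(** * Logarithm estimates and elementary line geometry over the reals *)

Section RealEstimates.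
Local Open Scope R_scope.

Lemma log2_le (y : R) (a : nat) : 0 < y -> y <= 2 ^ a -> log2 y <= INR a.
Proof.
intros y0 h; unfold log2.
assert (l2 : 0 < ln 2) by (rewrite <- ln_1; apply ln_increasing; lra).
apply Rmult_le_reg_r with (ln 2); [exact l2|].
unfold Rdiv; rewrite Rmult_assoc, Rinv_l, Rmult_1_r by lra.
rewrite <- ln_pow by lra.
destruct h as [h|h]; [left; apply ln_increasing; assumption|right; rewrite h; reflexivity].
Qed.

Lemma log2_ge (y : R) (a : nat) : 2 ^ a <= y -> INR a <= log2 y.
Proof.
intros h; unfold log2.
assert (l2 : 0 < ln 2) by (rewrite <- ln_1; apply ln_increasing; lra).
assert (p0 : 0 < 2 ^ a) by (apply pow_lt; lra).
apply Rmult_le_reg_r with (ln 2); [exact l2|].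
unfold Rdiv; rewrite Rmult_assoc, Rinv_l, Rmult_1_r by lra.
rewrite <- ln_pow by lra.
destruct h as [h|h]; [left; apply ln_increasing; assumption|right; rewrite h; reflexivity].
Qed.

(** The net parameter is k/sg, with sg the number of points. The iterated logarithm x is at most 5
    k, so x^(1/10) <= sqrt x <= 5 k / 2, and sg / (10 k) times 5 k / 2 is sg / 4. *)
Lemma net_bound_le (k sg : R) (E F : nat) :
    16 <= k -> 4 * k <= sg -> sg <= 2 ^ E -> INR E <= 2 ^ F -> INR F <= 5 * k ->
  / (10 * (k / sg)) * Rpower (log2 (log2 (/ (k / sg)))) (1 / 10) <= sg / 4.
Proof.
intros hk hs hE hF hF5.
replace (/ (k / sg)) with (sg / k) by (field; lra).
replace (/ (10 * (k / sg))) with (sg / (10 * k)) by (field; lra).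
assert (q4 : 4 <= sg / k) by (apply Rmult_le_reg_r with k; [lra|unfold Rdiv; rewrite Rmult_assoc, Rinv_l; lra]).
assert (qs : sg / k <= sg).
{ apply Rmult_le_reg_r with k; [lra|unfold Rdiv; rewrite Rmult_assoc, Rinv_l by lra; nra]. }
assert (l1 : INR 2 <= log2 (sg / k)) by (apply log2_ge; simpl; lra).
assert (l2 : log2 (sg / k) <= INR E) by (apply log2_le; lra).
set (w := log2 (sg / k)) in *; simpl in l1.
assert (l3 : INR 1 <= log2 w) by (apply log2_ge; simpl; lra).
assert (l4 : log2 w <= INR F) by (apply log2_le; lra).
set (x := log2 w) in *; simpl in l3.
assert (y1 : Rpower x (1 / 10) <= Rpower x (/ 2)) by (apply Rle_Rpower; lra).
rewrite Rpower_sqrt in y1 by lra.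
assert (s0 : 0 <= sqrt x) by apply sqrt_pos.
assert (ss : sqrt x * sqrt x = x) by (apply sqrt_sqrt; lra).
assert (s1 : sqrt x <= 5 / 2 * k) by nra.
replace (sg / 4) with (sg / (10 * k) * (5 / 2 * k)) by (field; lra).
apply Rmult_le_compat_l; [|lra].
apply Rmult_le_pos; [lra|left; apply Rinv_0_lt_compat; lra].
Qed.

Lemma line_equation (a b s v : R) : - b * s + 1 * v = a <-> v = a + s * b.
Proof. split; intros; lra. Qed.

Lemma lines_meet_once (a b a' b' X Y s v : R) :
  - b * X + 1 * Y = a -> - b' * X + 1 * Y = a' -> v = a + s * b -> v = a' + s * b' ->
  b <> b' -> s = X /\ v = Y.
Proof.
intros h1 h2 h3 h4 ne.
assert (e : (b - b') * (X - s) = 0) by (subst; lra).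
destruct (Rmult_integral _ _ e) as [z|z]; [lra|].
assert (X = s) by lra; subst; lra.
Qed.

(** The concurrency determinant with its negative terms moved across, so that for integer lines the
    identity can be pulled back from the reals to [nat]. *)
Lemma concurrent_identity (a1 b1 a2 b2 a3 b3 X Y : R) :
  - b1 * X + 1 * Y = a1 -> - b2 * X + 1 * Y = a2 -> - b3 * X + 1 * Y = a3 ->
  a2 * b3 + a3 * b1 + a1 * b2 = a3 * b2 + a2 * b1 + a1 * b3.
Proof. intros <- <- <-; ring. Qed.

Lemma parallel_lines_equal (a a' b s v : R) : v = a + s * b -> v = a' + s * b -> a = a'.
Proof. intros; lra. Qed.

Lemma net_ratio_lt (k sg eps : R) : 0 < eps -> 0 < k -> / eps < k -> k * k <= sg -> k / sg < eps.
Proof.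
intros e0 k0 h1 h2.
assert (s0 : 0 < sg) by nra.
apply Rmult_lt_reg_r with sg; [exact s0|].
unfold Rdiv; rewrite Rmult_assoc, Rinv_l, Rmult_1_r by lra.
assert (h3 : 1 < eps * k).
{ replace 1 with (eps * / eps) by (field; lra); apply Rmult_lt_compat_l; assumption. }
nra.
Qed.

Lemma INR_lt_quarter (tau sg : nat) : INR tau < INR sg / 4 -> (4 * tau <= sg)%nat.
Proof. intros h; apply INR_le; rewrite mult_INR; simpl; lra. Qed.

End RealEstimates.

From mathcomp Require Import all_boot all_order all_algebra.
From mathcomp Require Import zify ring lra.
Import Order.TTheory GRing.Theory Num.Theory.
Open Scope nat_scope.

(** * Averaging and counting inequalities *)

Section Averaging.
Local Open Scope ring_scope.
Variable K : realFieldType.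

Lemma exists_ge_average (X : finType) (As : {set X}) (f : X -> K) (c : K) :
  0 < c -> c <= \sum_(a in As) f a -> exists2 a, a \in As & c <= #|As|%:R * f a.
Proof.
move=> c0 le_c.
case: (boolP [exists a in As, c <= #|As|%:R * f a]).
  by case/existsP=> a /andP[aAs h]; exists a.
rewrite negb_exists => /forallP h; exfalso.
have As0 : (0 < #|As|)%N.
  rewrite card_gt0; apply: contraTneq le_c => ->.
  by rewrite big_set0 -ltNge.
have n0 : 0 < #|As|%:R :> K by rewrite ltr0n.
suff : \sum_(a in As) f a < c by rewrite ltNge le_c.
have -> : c = \sum_(a in As) c / #|As|%:R.
  by rewrite sumr_const -[RHS]mulr_natr mulfVK // gt_eqF.
apply: ltr_sum.
  by case/card_gt0P: As0 => a aAs; apply/hasP; exists a; rewrite ?mem_index_enum.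
move=> a aAs; rewrite ltr_pdivlMr // mulrC ltNge.
by have := h a; rewrite aAs.
Qed.

Lemma cauchy_schwarz_card (V : finType) (W : {set V}) (w : V -> K) :
  (\sum_(y in W) w y) ^+ 2 <= #|W|%:R * \sum_(y in W) w y ^+ 2.
Proof.
set A := \sum_(y in W) w y; set Z := \sum_(y in W) _.
have [W0|W0] := posnP #|W|.
  by rewrite /A W0 mul0r (cards0_eq W0) big_set0 expr0n.
have n0 : 0 < #|W|%:R :> K by rewrite ltr0n.
have : 0 <= \sum_(y in W) (#|W|%:R * w y - A) ^+ 2 by apply: sumr_ge0 => y _; exact: sqr_ge0.
have -> : \sum_(y in W) (#|W|%:R * w y - A) ^+ 2 = #|W|%:R * (#|W|%:R * Z - A ^+ 2).
  transitivity (\sum_(y in W) (#|W|%:R ^+ 2 * w y ^+ 2 - (2 * #|W|%:R * A) * w y + A ^+ 2)).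
    by apply: eq_bigr => y _; ring.
  rewrite big_split sumrB /= -!mulr_sumr -/A -/Z sumr_const.
  have -> : A *+ #|W| = #|W|%:R * A by rewrite mulr_natl.
  ring.
by rewrite pmulr_rge0 // subr_ge0.
Qed.

(** A single [a] must have large first moment, small second moment and small [B a] simultaneously.
    Averaging the first moment minus multiples of the other two finds it; Cauchy-Schwarz then makes
    the heavy set large. *)
Lemma heavy_points_average (X V : finType) (As : {set X}) (C : {set V})
    (w : X -> V -> K) (B : X -> K) (th th' D kap : K) :
    (forall a y, 0 <= w a y) -> (forall a, 0 <= B a) ->
    0 < th -> 0 < th' -> 0 < D -> 0 <= kap ->
    4 * #|As|%:R * kap * #|V|%:R <= th ->
    th <= \sum_(a in As) \sum_(y in C) w a y ->
    \sum_(a in As) B a <= th' ->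
    \sum_(a in As) \sum_(y in C) w a y ^+ 2 <= D ->
  exists2 a, a \in As & let W := [set y in C | kap <= w a y] in
    th ^+ 2 <= 16 * D * #|As|%:R * #|W|%:R /\
    B a * th ^+ 2 <= 16 * th' * D * #|W|%:R.
Proof.
move=> w0 B0 th0 th'0 D0 kap0 hkap hA hB hZ.
pose W a := [set y in C | kap <= w a y].
pose Aa a := \sum_(y in W a) w a y.
pose Za a := \sum_(y in C) w a y ^+ 2.
have splitA a : \sum_(y in C) w a y <= Aa a + kap * #|V|%:R.
  rewrite (bigID (fun y => kap <= w a y)) /=; apply: lerD.
    by rewrite le_eqVlt; apply/orP; left; apply/eqP/eq_bigl => y; rewrite inE.
  apply: (@le_trans _ _ (\sum_(y in C | ~~ (kap <= w a y)) kap)).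
    by apply: ler_sum => y /andP[_]; rewrite -ltNge => /ltW.
  rewrite sumr_const -[leLHS]mulr_natr ler_wpM2l // ler_nat.
  by rewrite -cardsE max_card.
(* Values below [kap] contribute at most th/4 in total. *)
have sumA : 3 / 4 * th <= \sum_(a in As) Aa a.
  have : th <= \sum_(a in As) (Aa a + kap * #|V|%:R).
    by apply: le_trans hA _; apply: ler_sum => a _.
  rewrite big_split /= sumr_const.
  have -> : (kap * #|V|%:R) *+ #|As| = #|As|%:R * (kap * #|V|%:R) by rewrite mulr_natl.
  lra.
(* Each penalty totals at most th/4, so th/4 survives out of 3/4 th. *)
pose l1 := th / (4 * th'); pose l2 := th / (4 * D).
have l10 : 0 < l1 by rewrite divr_gt0 // mulr_gt0.
have l20 : 0 < l2 by rewrite divr_gt0 // mulr_gt0.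
have hsum : th / 4 <= \sum_(a in As) (Aa a - l1 * B a - l2 * Za a).
  rewrite !sumrB -!mulr_sumr.
  have e1 : l1 * \sum_(a in As) B a <= th / 4.
    apply: le_trans (_ : l1 * th' <= _); first by rewrite ler_pM2l.
    by rewrite le_eqVlt; apply/orP; left; apply/eqP; rewrite /l1; field; rewrite gt_eqF.
  have e2 : l2 * \sum_(a in As) Za a <= th / 4.
    apply: le_trans (_ : l2 * D <= _); first by rewrite ler_pM2l.
    by rewrite le_eqVlt; apply/orP; left; apply/eqP; rewrite /l2; field; rewrite gt_eqF.
  lra.
have th40 : 0 < th / 4 by lra.
have [a aAs ha] := exists_ge_average _ _ _ _ th40 hsum.
exists a => //; rewrite -/(W a) /=.
have n0 : 0 < #|As|%:R :> K.
  by rewrite ltr0n card_gt0; apply/set0Pn; exists a.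
have Z0 : 0 <= Za a by apply: sumr_ge0 => y _; exact: sqr_ge0.
set f := Aa a - l1 * B a - l2 * Za a in ha.
have f0 : 0 < f by rewrite -(pmulr_rgt0 _ n0); lra.
have lB : 0 <= l1 * B a by rewrite mulr_ge0 // ltW.
have lZ : 0 <= l2 * Za a by rewrite mulr_ge0 // ltW.
have A0 : 0 < Aa a by rewrite /f in f0; lra.
have A1 : th / 4 <= #|As|%:R * Aa a.
  by apply: le_trans ha _; rewrite ler_pM2l // /f; lra.
have ZA : l2 * Za a <= Aa a by rewrite /f in f0; lra.
have BA : l1 * B a <= Aa a by rewrite /f in f0; lra.
have cs : Aa a ^+ 2 <= #|W a|%:R * Za a.
  apply: le_trans (cauchy_schwarz_card _ _ _) _; rewrite ler_wpM2l //.
  rewrite /Za [leRHS](bigID (fun y => kap <= w a y)) /=.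
  rewrite [leLHS](eq_bigl (fun y => (y \in C) && (kap <= w a y))); last by move=> y; rewrite inE.
  by rewrite lerDl; apply: sumr_ge0 => y _; exact: sqr_ge0.
have AW : th * Aa a <= 4 * D * #|W a|%:R.
  have h1 : l2 * Aa a ^+ 2 <= #|W a|%:R * Aa a.
    apply: le_trans (_ : #|W a|%:R * (l2 * Za a) <= _); last by rewrite ler_wpM2l.
    by rewrite [leRHS]mulrCA ler_pM2l.
  have h2 : l2 * Aa a <= #|W a|%:R by rewrite -(ler_pM2r A0) -mulrA -expr2.
  have -> : th * Aa a = 4 * D * (l2 * Aa a).
    by rewrite /l2; field; rewrite gt_eqF.
  by rewrite ler_pM2l // mulr_gt0.
have BA' : th * B a <= 4 * th' * Aa a.
  have -> : th * B a = 4 * th' * (l1 * B a).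
    by rewrite /l1; field; rewrite gt_eqF.
  by rewrite ler_pM2l // mulr_gt0.
split.
  apply: le_trans (_ : 4 * #|As|%:R * (th * Aa a) <= _).
    have -> : 4 * #|As|%:R * (th * Aa a) = th * (4 * (#|As|%:R * Aa a)) by ring.
    by rewrite expr2 ler_pM2l //; lra.
  have -> : 16 * D * #|As|%:R * #|W a|%:R = 4 * #|As|%:R * (4 * D * #|W a|%:R) by ring.
  by rewrite ler_pM2l // mulr_gt0.
apply: le_trans (_ : 4 * th' * (th * Aa a) <= _).
  have -> : B a * th ^+ 2 = th * (th * B a) by ring.
  have -> : 4 * th' * (th * Aa a) = th * (4 * th' * Aa a) by ring.
  by rewrite ler_pM2l.
have -> : 16 * th' * D * #|W a|%:R = 4 * th' * (4 * D * #|W a|%:R) by ring.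
by rewrite ler_pM2l // mulr_gt0.
Qed.

End Averaging.

Lemma sum_bool_card (T : finType) (p : pred T) : \sum_(A : T) (p A : nat) = #|[set A | p A]|.
Proof. by rewrite cardsE -sum1_card [RHS]big_mkcond; apply: eq_bigr => A _; rewrite -topredE /=; case: (p A). Qed.

Lemma leq_bin_expn n j : 'C(n, j) <= n ^ j.
Proof.
apply: leq_trans (_ : n ^_ j <= _).
  by rewrite -bin_ffact leq_pmulr // fact_gt0.
rewrite ffact_prod -[X in n ^ X]card_ord -prod_nat_const.
by apply: leq_prod => i _; apply: leq_subr.
Qed.

Lemma card_sets_of_size (T : finType) j : #|[set a : {set T} | #|a| == j]| <= #|T| ^ j.
Proof. by rewrite card_draws leq_bin_expn. Qed.

(** * Collinear configurations of sample indices and their one-point extensions *)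

Section Configurations.
Variables (V L P : finType) (inc : L -> {set V}) (m : nat).
Notation I := (P * 'I_m)%type.
Implicit Types (x : {ffun I -> V}) (A U : {set I}) (l : L) (LL : {set L}) (a : {set P}).

Definition parts A : {set P} := [set u.1 | u in A].

(** One index per block, so that an index removed from a configuration lies outside the blocks of
    the others; distinct images, so that [#|A|] indices exhibit that many points on the line. *)
Definition conf x A l :=
  [&& #|parts A| == #|A|, #|x @: A| == #|A| & x @: A \subset inc l].

Definition nconf x U LL j :=
  \sum_(l in LL) \sum_(A : {set I}) ([&& A \subset U, #|A| == j & conf x A l] : nat).

(** The number of ways in which a hypothetical sample point y would extend a configuration with
    block set exactly [a]. *)
Definition wt x U LL a (y : V) :=
  \sum_(l in LL) \sum_(A : {set I})
    ([&& y \in inc l, A \subset U, parts A == a, conf x A l & y \notin x @: A] : nat).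

Lemma nconf_mono x U LL LL' j : LL \subset LL' -> nconf x U LL j <= nconf x U LL' j.
Proof.
move=> /subsetP s; rewrite /nconf [leqRHS](bigID (fun l => l \in LL)) /=.
apply: leq_trans (leq_addr _ _); rewrite leq_eqVlt; apply/orP; left; apply/eqP.
by apply: eq_bigl => l; case: (boolP (l \in LL)) => [/s ->|]; rewrite ?andbF.
Qed.

Lemma wt_mono x U LL a y : wt x U LL a y <= wt x setT setT a y.
Proof.
rewrite /wt [leqRHS](bigID (fun l => l \in LL)) /=.
apply: leq_trans (leq_addr _ _).
rewrite [leqRHS](eq_bigl (fun l => l \in LL)) => [|l]; last by rewrite inE.
apply: leq_sum => l _; apply: leq_sum => A _.
by rewrite subsetT /=; case: (y \in inc l) => //=; case: (A \subset U).
Qed.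

Lemma nconf0 x U LL : nconf x U LL 0 = #|LL|.
Proof.
rewrite /nconf -sum1_card; apply: eq_bigr => l _.
rewrite (bigD1 set0) //= big1 => [|A An0]; last by rewrite cards_eq0 (negbTE An0) /= andbF.
by rewrite /conf /parts !imset0 !sub0set !cards0.
Qed.

(** A configuration of j indices covers only j points of its line, so some further point of C on
    that line extends it. *)
Lemma nconf_le_sum_wt x U LL (C : {set V}) j :
    (forall l, l \in LL -> j < #|inc l :&: C|) ->
  nconf x U LL j <= \sum_(a in [set a : {set P} | #|a| == j]) \sum_(y in C) wt x U LL a y.
Proof.
move=> rich.
have -> : \sum_(a in [set a : {set P} | #|a| == j]) \sum_(y in C) wt x U LL a y =
  \sum_(l in LL) \sum_(A : {set I}) \sum_(a in [set a : {set P} | #|a| == j]) \sum_(y in C)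
    ([&& y \in inc l, A \subset U, parts A == a, conf x A l & y \notin x @: A] : nat).
  under eq_bigr => a _ do rewrite exchange_big /=.
  rewrite exchange_big; apply: eq_bigr => l _.
  under eq_bigr => a _ do rewrite exchange_big /=.
  by rewrite exchange_big.
apply: leq_sum => l lLL; apply: leq_sum => A _.
case: (boolP [&& _, _ & _]) => // /and3P[sAU cA cf].
have /and3P[/eqP cp /eqP cx _] := cf.
have /card_gt0P[y] : 0 < #|(inc l :&: C) :\: x @: A|.
  rewrite cardsD subn_gt0; apply: leq_ltn_trans (rich l lLL).
  by rewrite -(eqP cA) -cx; apply/subset_leq_card/subsetIr.
rewrite !inE => /and3P[yA yl yC].
rewrite (bigD1 (parts A)) ?inE ?cp //= (bigD1 y) //= yl sAU eqxx cf yA /=.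
by rewrite -addnA leq_addr.
Qed.

(** An index u in a new block turns the j-configuration A into u |: A, and a (j+1)-configuration
    arises once at most for each choice of u among its j+1 indices. *)
Lemma sum_wt_le_nconf x U LL j :
  \sum_(a in [set a : {set P} | #|a| == j]) \sum_(u in U | u.1 \notin a) wt x U LL a (x u)
    <= j.+1 * nconf x U LL j.+1.
Proof.
have -> : \sum_(a in [set a : {set P} | #|a| == j])
    \sum_(u in U | u.1 \notin a) wt x U LL a (x u) =
  \sum_(l in LL) \sum_(A : {set I}) \sum_(a in [set a : {set P} | #|a| == j])
   \sum_(u in U | u.1 \notin a)
    ([&& x u \in inc l, A \subset U, parts A == a, conf x A l & x u \notin x @: A] : nat).
  under eq_bigr => a _ do rewrite exchange_big /=.
  rewrite exchange_big; apply: eq_bigr => l _.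
  under eq_bigr => a _ do rewrite exchange_big /=.
  by rewrite exchange_big.
rewrite /nconf big_distrr /=; apply: leq_sum => l lLL.
pose good A u := [&& u \in U, u.1 \notin parts A, x u \in inc l, A \subset U, #|A| == j,
  conf x A l & x u \notin x @: A].
apply: (@leq_trans (\sum_(u : I) \sum_(A : {set I}) (good A u : nat))).
  rewrite [leqRHS]exchange_big /=; apply: leq_sum => A _.
  case: (boolP (#|parts A| == j)) => cA; last first.
    rewrite big1 // => a; rewrite inE => ca; rewrite big1 // => u _.
    by case: eqP => [e|]; rewrite ?andbF //; rewrite -e (negbTE cA) in ca.
  rewrite (bigD1 (parts A)) ?inE //= [X in _ + X]big1 => [|a /andP[_ ne]]; last first.
    by rewrite big1 // => u _; rewrite eq_sym (negbTE ne) !andbF.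
  rewrite addn0 eqxx /= big_mkcond /=; apply: leq_sum => u _.
  rewrite /good; case: (u \in U) => //=; case: (u.1 \notin _) => //=.
  case: (x u \in inc l) => //=; case: (A \subset U) => //=.
  case cf: (conf x A l); rewrite ?andbF //=.
  by case/and3P: cf => /eqP <- _ _; rewrite cA.
apply: (@leq_trans (\sum_(u : I) \sum_(A : {set I})
   ((u \in A) && [&& A \subset U, #|A| == j.+1 & conf x A l] : nat))).
  apply: leq_sum => u _; rewrite !sum_bool_card.
  rewrite -(@card_in_imset _ _ (fun A => u |: A)); last first.
    move=> A B; rewrite !inE => /and5P[_ uA _ _ _] /and5P[_ uB _ _ _] e.
    have nu D : u.1 \notin parts D -> u \notin D.
      by apply: contra => uD; apply/imsetP; exists u.
    by rewrite -(setU1K (nu _ uA)) e (setU1K (nu _ uB)).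
  apply/subset_leq_card/subsetP => D /imsetP[A]; rewrite !inE.
  case/and5P=> uU uA xul sAU /and3P[cA /and3P[/eqP c1 /eqP c2 c3] xuA] ->.
  have uA' : u \notin A by apply: contra uA => uD; apply/imsetP; exists u.
  rewrite setU11 subUset sub1set uU sAU /= cardsU1 uA' (eqP cA) eqxx /=.
  by rewrite /conf /parts !imsetU1 !cardsU1 uA uA' xuA -/(parts A) c1 c2 !eqxx subUset sub1set xul c3.
rewrite exchange_big big_distrr /=; apply: leq_sum => A _.
case: (boolP [&& _, _ & _]) => [/and3P[_ cA _]|_]; last first.
  by rewrite big1 // => u _; rewrite andbF.
under eq_bigr => u _ do rewrite andbT.
by rewrite sum_bool_card muln1 -(eqP cA) subset_leq_card //; apply/subsetP => u; rewrite inE.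
Qed.

End Configurations.

(** * Deleting heavy sets: one round and its iteration *)

Section Fingerprints.
Local Open Scope ring_scope.
Variables (K : realFieldType) (V L P : finType) (inc : L -> {set V}) (m k : nat) (kp : nat -> K).
Notation I := (P * 'I_m)%type.
Notation wt := (@wt V L P inc m).
Notation nconf := (@nconf V L P inc m).
Implicit Types (x : {ffun I -> V}) (U : {set I}) (C : {set V}) (a : {set P}) (s : seq {set P}).

Definition rich C : {set L} := [set l | (k <= #|inc l :&: C|)%N].

Definition heavy x U C a : {set V} := [set y in C | kp #|a| <= (wt x U (rich C) a y)%:R].

(* A fingerprint [s] lists the groups of blocks used by the successive rounds of deletion; the
   surviving region [run x U s] is determined by [U] and the sample on those blocks. *)
Definition run_from x U C s := foldl (fun C a => C :\: heavy x U C a) C s.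

Definition run x U s := run_from x U setT s.

Definition untouched s (u : I) := all (fun a => u.1 \notin a) s.

(** [wt] at [a] sees only index sets whose blocks are exactly [a]. *)
Lemma heavy_local x x' U C a :
  (forall u, u.1 \in a -> x u = x' u) -> heavy x U C a = heavy x' U C a.
Proof.
move=> e; apply/setP => y; rewrite !inE; congr (_ && _); congr (_ <= _%:R).
apply: eq_bigr => l _; apply: eq_bigr => A _.
case: eqP => [pA|]; rewrite ?andbF //=.
suff exA : x @: A = x' @: A by rewrite /conf exA.
by apply: eq_in_imset => u uA; apply: e; rewrite -pA; apply/imsetP; exists u.
Qed.

Lemma run_local x x' U s :
  (forall u, ~~ untouched s u -> x u = x' u) -> run x U s = run x' U s.
Proof.
rewrite /run; move: [set: V]; elim: s => [|a s IH] C e //=.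
rewrite (@heavy_local x x') => [|u ua]; last by apply: e; rewrite /= ua.
by apply: IH => u us; apply: e; rewrite /= negb_and us orbT.
Qed.

Variables (th D : nat -> K) (gam : K) (De n : nat).
Hypothesis V0 : (0 < #|V|)%N.
Hypothesis gam0 : 0 < gam.
Hypothesis kp0 : forall j, 0 < kp j.
Hypothesis th0 : forall j, 0 < th j.
Hypothesis D0 : forall j, 0 < D j.
Hypothesis kp_small : forall j, (j < k)%N -> 4 * (#|P| ^ j)%:R * kp j * #|V|%:R <= th j.
Hypothesis gam_small : forall j, (j < k)%N ->
  16 * D j * (#|P| ^ j)%:R * (gam * #|V|%:R) <= th j ^+ 2.
Hypothesis th_drop : forall j, (j < k)%N ->
  16 * (k%:R * th j.+1) * D j * (8 * #|V|%:R) <= kp j * th j ^+ 2 * n%:R.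
Hypothesis supersat : forall C, (#|V| <= De * #|C|)%N -> th 0 <= #|rich C|%:R.

(** Stated for all indices and all lines: by monotonicity of [wt], this one condition bounds the
    second moments for every U and every surviving region. *)
Definition tame x := forall j, (j < k)%N ->
  \sum_(a in [set a : {set P} | #|a| == j]) \sum_(y : V) ((wt x setT setT a y) ^ 2)%:R <= D j.

Lemma round x U C : tame x -> (#|V| <= De * #|C|)%N -> (nconf x U setT k)%:R < th k ->
  exists a, [/\ (#|a| < k)%N, gam * #|V|%:R <= #|heavy x U C a|%:R &
    (8 * #|V| * #|[set u in U | (u.1 \notin a) && (x u \in heavy x U C a)]|
       <= n * #|heavy x U C a|)%N].
Proof.
move=> tx hC hk.
have N0 : th 0 <= (nconf x U (rich C) 0)%:R by rewrite nconf0 supersat.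
have Nk : (nconf x U (rich C) k)%:R < th k.
  by apply: le_lt_trans hk; rewrite ler_nat nconf_mono // subsetT.
(* The counts start above the threshold at level 0 and end below it at level k, so they cross at
   some j. *)
have [j jk [Nj Nj1]] : exists2 j, (j < k)%N &
    th j <= (nconf x U (rich C) j)%:R /\ (nconf x U (rich C) j.+1)%:R < th j.+1.
  move: Nk; elim: k => [|i IH] h; first by move: N0; rewrite leNgt h.
  case: (leP (th i) (nconf x U (rich C) i)%:R) => hi; first by exists i.
  by have [j ji h'] := IH hi; exists j => //; exact: ltnW.
set As := [set a : {set P} | #|a| == j].
have cAs : #|As|%:R <= (#|P| ^ j)%:R :> K by rewrite ler_nat card_sets_of_size.
have k0 : 0 < k%:R :> K by rewrite ltr0n; lia.
have [||||||||||a aAs [hW hB]] := @heavy_points_average K _ _ As C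
   (fun a y => (wt x U (rich C) a y)%:R)
   (fun a => (\sum_(u in U | u.1 \notin a) wt x U (rich C) a (x u))%:R)
   (th j) (k%:R * th j.+1) (D j) (kp j) => //.
- by rewrite mulr_gt0.
- exact: ltW.
- apply: le_trans (kp_small _ jk); rewrite ler_pM2r ?ltr0n // ler_pM2r //.
  by rewrite ler_pM2l.
- apply: le_trans Nj _; rewrite -[leRHS](eq_bigr _ (fun a _ => natr_sum _ _ _ _)) -natr_sum ler_nat.
  apply: nconf_le_sum_wt => l; rewrite inE => h; exact: leq_trans h.
- rewrite -natr_sum; apply: le_trans (_ : (j.+1 * nconf x U (rich C) j.+1)%:R <= _).
    by rewrite ler_nat sum_wt_le_nconf.
  by rewrite natrM; apply: ler_pM; rewrite ?ler0n ?ler_nat // ltW.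
- apply: le_trans (tx j jk); apply: ler_sum => a _.
  rewrite big_mkcond; apply: ler_sum => y _; case: ifP => // _.
  by rewrite -natrX ler_nat leq_exp2r // wt_mono.
exists a; move: aAs; rewrite inE => /eqP ca.
have eW : [set y in C | kp j <= (wt x U (rich C) a y)%:R] = heavy x U C a.
  by rewrite /heavy ca.
rewrite /= eW in hW hB; split; first by rewrite ca.
  have d0 : 0 < 16 * D j * (#|P| ^ j)%:R.
    have : 0 < 16 * D j * #|As|%:R * #|heavy x U C a|%:R.
      by apply: lt_le_trans hW; rewrite exprn_gt0.
    have h16 : 0 < 16 * D j by rewrite mulr_gt0.
    rewrite -mulrA (pmulr_rgt0 _ h16) => h; rewrite mulr_gt0 //.
    apply: lt_le_trans cAs; rewrite lt_def ler0n andbT.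
    by apply: contraTneq h => ->; rewrite mul0r ltxx.
  rewrite -(ler_pM2l d0); apply: le_trans (gam_small _ jk) _.
  apply: le_trans hW _; rewrite ler_wpM2r // ler_wpM2l // mulr_ge0 // ltW //.
set Ms := [set u in U | _].
(* Each index landing in the heavy set contributes at least [kp j], so the bound on this sum, the
   [B a] of the averaging lemma, limits their number. *)
have hM : kp j * #|Ms|%:R <= (\sum_(u in U | u.1 \notin a) wt x U (rich C) a (x u))%:R.
  apply: (@le_trans _ _ (\sum_(u in Ms) (wt x U (rich C) a (x u))%:R)).
    rewrite -sum1_card natr_sum mulr_sumr; apply: ler_sum => u.
    by rewrite !inE ca mulr1 => /and4P[].
  rewrite -natr_sum ler_nat [leqRHS](bigID (fun u => x u \in heavy x U C a)) /=.
  apply: leq_trans (leq_addr _ _); rewrite leq_eqVlt; apply/orP; left; apply/eqP.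
  by apply: eq_bigl => u; rewrite inE -andbA.
set W := heavy x U C a in hB hM *.
have t0 : 0 < kp j * th j ^+ 2 by rewrite mulr_gt0 // exprn_gt0.
rewrite -(ler_nat K) -(ler_pM2l t0).
have -> : kp j * th j ^+ 2 * (8 * #|V| * #|Ms|)%:R = (kp j * #|Ms|%:R) * (th j ^+ 2) * (8 * #|V|%:R).
  by rewrite !natrM; ring.
apply: le_trans (_ : 16 * (k%:R * th j.+1) * D j * #|W|%:R * (8 * #|V|%:R) <= _).
  rewrite ler_wpM2r ?mulr_ge0 //; apply: le_trans hB.
  by rewrite ler_wpM2r // exprn_ge0 // ltW.
rewrite natrM mulrAC [leRHS]mulrA ler_wpM2r //; exact: th_drop.
Qed.

(** Each round deletes a proportion [gam] of V, so Q rounds cannot all take place. The deleted sets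
    are disjoint, so the per-round bounds add up: at most n/8 untouched indices of U lie outside the
    final region. *)
Lemma process x U Q : tame x -> (nconf x U setT k)%:R < th k -> 1 < gam * Q%:R ->
  exists s, [/\ (size s <= Q)%N, all (fun a => #|a| < k)%N s,
    (De * #|run x U s| < #|V|)%N &
    (8 * #|V| * #|[set u in U | untouched s u && (x u \notin run x U s)]|
       <= n * #|V|)%N].
Proof.
move=> tx hk hQ.
(* The disjunction allows an early stop: a region that is already small is kept unchanged. *)
have inv t : exists s, [/\ (size s <= t)%N, all (fun a => #|a| < k)%N s,
    (8 * #|V| * #|[set u in U | untouched s u && (x u \notin run x U s)]|
       <= n * #|~: run x U s|)%N &
    (De * #|run x U s| < #|V|)%N \/ gam * t%:R * #|V|%:R <= #|~: run x U s|%:R].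
  elim: t => [|t [s [sz al ms]]].
    exists [::]; split => //; last by right; rewrite mulr0 mul0r.
    rewrite (_ : [set u in U | _] = set0) ?cards0 ?muln0 //.
    by apply/setP => u; rewrite !inE andbF.
  case=> [done|big]; first by exists s; split => //; [exact: leqW|left].
  case: (ltnP (De * #|run x U s|) #|V|) => [done|hC].
    by exists s; split => //; [exact: leqW|left].
  set C := run x U s in ms big hC.
  have [a [ak hW hM]] := @round x U C tx hC hk.
  exists (rcons s a).
  have e : run x U (rcons s a) = C :\: heavy x U C a by rewrite /run /run_from foldl_rcons.
  set W := heavy x U C a in hW hM e.
  have WC : W \subset C by apply/subsetP => y; rewrite inE => /andP[].
  clearbody W.
  have cC : #|~: run x U (rcons s a)| = (#|~: C| + #|W|)%N.
    rewrite e setDE setCI setCK cardsU (_ : _ :&: W = set0) ?cards0 ?subn0 //.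
    by apply/setP => y; rewrite !inE; case: (boolP (y \in W)) => [/(subsetP WC) ->|]; rewrite ?andbF.
  split; first by rewrite size_rcons.
  - by rewrite all_rcons ak.
  - rewrite cC mulnDr; apply: leq_trans (leq_add ms hM); rewrite -mulnDr leq_mul2l.
    apply/orP; right; apply: leq_trans (leq_card_setU _ _).
    apply/subset_leq_card/subsetP => u; rewrite e !inE /untouched all_rcons.
    case: (u \in U) => //= /andP[/andP[ua us]]; rewrite us ua /=.
    by case: (x u \in W); rewrite ?orbT //= => ->.
  - right; rewrite cC natrD -natr1 mulrDr mulr1 mulrDl; exact: lerD.
have [s [sz al ms fin]] := inv Q; exists s; split => //.
  case: fin => // h; exfalso.
  suff : #|V|%:R < #|V|%:R :> K by rewrite ltxx.
  apply: lt_le_trans (_ : gam * Q%:R * #|V|%:R <= _).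
    by rewrite ltr_pMl // ltr0n.
  by apply: le_trans h _; rewrite ler_nat max_card.
by apply: leq_trans ms _; rewrite leq_mul2l max_card orbT.
Qed.

End Fingerprints.

(** * Independent coordinates falling into a region that ignores them *)

Section FreshCoordinates.
Variables (I V : finType) (De : nat).
Notation X := {ffun I -> V}.
Hypothesis V0 : 0 < #|V|.

Definition upd (x : X) u v : X := [ffun w => if w == u then v else x w].

Lemma card_fresh_coordinate (Pr : pred X) (C : X -> {set V}) u :
    (forall x v, Pr (upd x u v) = Pr x) -> (forall x v, C (upd x u v) = C x) ->
    (forall x, Pr x -> De * #|C x| <= #|V|) ->
  De * #|[set x | Pr x && (x u \in C x)]| <= #|[set x | Pr x]|.
Proof.
move=> hP hC hDe; set S1 := [set x | Pr x && _].
rewrite -(leq_pmul2r V0).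
(* [phi] exchanges the coordinate x u with the spare value v and is its own inverse. As [Pr] and C
   ignore u, the event x u in C x becomes v in C x. *)
pose phi (xv : X * V) := (upd xv.1 u xv.2, xv.1 u).
have inj : injective phi.
  apply: (can_inj (g := fun zw => (upd zw.1 u zw.2, zw.1 u))) => -[x v] /=.
  congr pair; last by rewrite /upd ffunE eqxx.
  by apply/ffunP => w; rewrite !ffunE; case: eqP => [->|].
have le1 : #|S1| * #|V| <= \sum_(z in [set x | Pr x]) #|C z|.
  rewrite -[#|V|]cardsT -cardsX -(card_imset _ inj).
  apply: (@leq_trans #|[set zw : X * V | Pr zw.1 && (zw.2 \in C zw.1)]|).
    apply/subset_leq_card/subsetP => zw /imsetP[[x v]]; rewrite !inE => /andP[/andP[p c] _] ->.
    by rewrite /phi /= hP hC p c.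
  rewrite -sum1_card (eq_bigl (fun p : X * V => Pr p.1 && (p.2 \in C p.1))); last first.
    by move=> p; rewrite inE.
  rewrite -(pair_big_dep Pr (fun x v => v \in C x) (fun _ _ => 1)) /= big_mkcond [leqRHS]big_mkcond.
  by apply: leq_sum => z _; rewrite inE; case: (Pr z) => //; rewrite sum1_card.
rewrite -mulnA; apply: leq_trans (leq_mul (leqnn De) le1) _.
rewrite big_distrr /= -sum_nat_const.
by apply: leq_sum => z; rewrite inE => /hDe.
Qed.

(** Conditioned on the coordinates outside B, the region is fixed and the coordinates in B are
    independent, so each one gains a factor 1/De. *)
Lemma card_fresh_coordinates (C : X -> {set V}) (B : {set I}) :
    (forall x x' : X, (forall u, u \notin B -> x u = x' u) -> C x = C x') ->
  De ^ #|B| * #|[set x | (De * #|C x| <= #|V|) && [forall u in B, x u \in C x]]|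
    <= #|V| ^ #|I|.
Proof.
move=> hC.
suff h (s : seq I) : uniq s -> {subset s <= B} ->
    De ^ size s * #|[set x | (De * #|C x| <= #|V|) && all (fun u => x u \in C x) s]| <= #|V| ^ #|I|.
  have := h (enum B) (enum_uniq _); rewrite -cardE => h'.
  apply: leq_trans (h' _); last by move=> u; rewrite mem_enum.
  rewrite leq_mul2l; apply/orP; right; apply/subset_leq_card/subsetP => x.
  rewrite !inE => /andP[-> /forallP f]; apply/allP => u; rewrite mem_enum => uB.
  by have := f u; rewrite uB.
elim: s => [|u s IH] /=; first by move=> _ _; rewrite expn0 mul1n -card_ffun max_card.
case/andP=> us uqs sB.
apply: leq_trans (IH uqs _); last by move=> w ws; apply: sB; rewrite inE ws orbT.
have hu x v : C (upd x u v) = C x.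
  apply: hC => w wB; rewrite ffunE; case: eqP => // e.
  by rewrite e sB ?inE ?eqxx in wB.
rewrite expnSr -mulnA leq_mul2l; apply/orP; right.
apply: leq_trans (card_fresh_coordinate
  (fun x => (De * #|C x| <= #|V|) && all (fun u => x u \in C x) s) C u _ hu _).
- rewrite leq_mul2l; apply/orP; right; apply/subset_leq_card/subsetP => x.
  by rewrite !inE => /and3P[-> -> ->].
- move=> x v; rewrite hu; congr (_ && _); apply: eq_in_all => w ws.
  by rewrite ffunE; case: eqP => // e; rewrite -e ws in us.
- by move=> x /andP[].
Qed.

End FreshCoordinates.

(** * Union bound over index sets and fingerprints *)

Section UnionBound.
Local Open Scope ring_scope.
Variables (K : realFieldType) (V L P : finType) (inc : L -> {set V}) (m k : nat) (kp : nat -> K).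
Notation I := (P * 'I_m)%type.
Notation run := (@run K V L P inc m k kp).
Notation nconf := (@nconf V L P inc m).
Variables (De Q b : nat).
Hypothesis V0 : (0 < #|V|)%N.

Definition fingerprint_fits (x : {ffun I -> V}) (U B : {set I}) (s : seq {set P}) :=
  [&& (b <= #|B|)%N, [forall u in B, untouched _ _ s u],
     (De * #|run x U s| <= #|V|)%N & [forall u in B, x u \in run x U s]].

(* Fingerprints of length at most [Q] are encoded as [Q]-tuples of options. *)
Definition captured : {set {ffun I -> V}} :=
  [set x | [exists U : {set I}, exists t : Q.-tuple (option {set P}), exists B : {set I},
     fingerprint_fits x U B (pmap id t)]].

(** The three exponents of 2 count the choices of U, of the padded fingerprint and of B; a fixed
    triple fits with probability at most De^(-b). *)
Lemma card_captured :
  (0 < De)%N ->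
  (De ^ b * #|captured| <= #|V| ^ #|{: I}| * 2 ^ (#|{: I}| + #|P|.+1 * Q + #|{: I}|))%N.
Proof.
move=> De0.
pose E U t B := [set x : {ffun I -> V} | fingerprint_fits x U B (pmap id (t : Q.-tuple (option {set P})))].
have cE U t B : (De ^ b * #|E U t B| <= #|V| ^ #|{: I}|)%N.
  case: (boolP ((b <= #|B|)%N && [forall u in B, untouched _ _ (pmap id t) u])) => [/andP[bB un]|no].
    apply: leq_trans (card_fresh_coordinates _ _ De V0 (fun x => run x U (pmap id t)) B _).
      apply: leq_mul; first by rewrite leq_pexp2l.
      by apply/subset_leq_card/subsetP => x; rewrite !inE => /and4P[_ _ -> ->].
    move=> x x' e; apply: run_local => u nt; apply: e; apply: contra nt => uB.
    by move/forallP/(_ u): un; rewrite uB.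
  rewrite [E U t B](_ : _ = set0) ?cards0 ?muln0 //; apply/setP => x; rewrite !inE.
  by rewrite /fingerprint_fits andbA (negbTE no).
have sub : captured \subset \bigcup_U \bigcup_t \bigcup_B E U t B.
  apply/subsetP => x; rewrite inE => /existsP[U /existsP[t /existsP[B h]]].
  by apply/bigcupP; exists U => //; apply/bigcupP; exists t => //; apply/bigcupP; exists B; rewrite // inE.
have cU (T J : finType) (F : J -> {set T}) c : (forall j, (De ^ b * #|F j| <= c)%N) ->
    (De ^ b * #|\bigcup_j F j| <= c * #|J|)%N.
  move=> h; apply: leq_trans (_ : De ^ b * \sum_j #|F j| <= _)%N.
    rewrite leq_mul2l; apply/orP; right; elim/big_rec2: _ => [|j n S _ IH]; first by rewrite cards0.
    by apply: leq_trans (leq_card_setU _ _) _; rewrite leq_add2l.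
  rewrite big_distrr /= mulnC -sum_nat_const; exact: leq_sum.
apply: leq_trans (_ : De ^ b * #|\bigcup_U \bigcup_t \bigcup_B E U t B| <= _)%N.
  by rewrite leq_mul2l subset_leq_card ?orbT.
apply: leq_trans (cU _ _ _ _ (fun U => cU _ _ _ _ (fun t => cU _ _ _ _ (fun B => cE U t B)))) _.
have cs (T : finType) : #|{: {set T}}| = (2 ^ #|T|)%N.
  by rewrite -[in RHS]cardsT -card_powerset powersetT cardsT.
rewrite !cs card_tuple card_option cs !expnD expnM.
have le2 : ((2 ^ #|P|).+1 ^ Q <= (2 ^ #|P|.+1) ^ Q)%N.
  case: (posnP Q) => [->|Q0]; first by rewrite !expn0.
  rewrite leq_exp2r // expnS; have : (0 < 2 ^ #|P|)%N by rewrite expn_gt0.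
  lia.
rewrite -!mulnA; apply: leq_mul => //; apply: leq_mul => //.
by rewrite mulnA -expnMn -expnS leq_mul.
Qed.

Variables (th D : nat -> K) (gam : K).
Notation n := #|{: I}|.
Hypothesis gam0 : 0 < gam.
Hypothesis kp0 : forall j, 0 < kp j.
Hypothesis th0 : forall j, 0 < th j.
Hypothesis D0 : forall j, 0 < D j.
Hypothesis kp_small : forall j, (j < k)%N -> 4 * (#|P| ^ j)%:R * kp j * #|V|%:R <= th j.
Hypothesis gam_small : forall j, (j < k)%N ->
  16 * D j * (#|P| ^ j)%:R * (gam * #|V|%:R) <= th j ^+ 2.
Hypothesis th_drop : forall j, (j < k)%N ->
  16 * (k%:R * th j.+1) * D j * (8 * #|V|%:R) <= kp j * th j ^+ 2 * n%:R.
Hypothesis supersat : forall C : {set V}, (#|V| <= De * #|C|)%N ->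
  th 0 <= #|rich _ _ inc k C|%:R.
Hypothesis Qbig : 1 < gam * Q%:R.
Hypothesis few_touched : (8 * k * Q <= #|P|)%N.
Hypothesis b_small : (4 * b <= n)%N.

Lemma card_touched (s : seq {set P}) :
  (#|[set u : I | ~~ untouched _ m s u]| <= m * \sum_(a <- s) #|a|)%N.
Proof.
elim: s => [|a s IH].
  by rewrite big_nil muln0 leqn0 cards_eq0; apply/eqP/setP => u; rewrite !inE.
rewrite big_cons mulnDr; apply: leq_trans (leq_add (leqnn _) IH).
have <- : #|setX a [set: 'I_m]| = (m * #|a|)%N by rewrite cardsX cardsT card_ord mulnC.
apply: leq_trans (leq_card_setU _ _); apply/subset_leq_card/subsetP => -[p i].
by rewrite !inE /untouched /= negb_and negbK andbT.
Qed.

(** Of at least n/2 indices in U, at most n/8 are touched by the fingerprint and at most n/8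
    untouched ones lie outside the region. The remaining n/4 >= b would make x captured. *)
Lemma dense_index_sets_have_configurations x (U : {set I}) :
    tame K V L P inc m k D x -> x \notin captured -> (n <= 2 * #|U|)%N ->
  th k <= (nconf x U setT k)%:R.
Proof.
move=> tx nc hU; rewrite leNgt; apply: contra nc => few.
have [s [sz al sm ms]] := @process K V L P inc m k kp th D gam De n V0 gam0 kp0 th0 D0
  kp_small gam_small th_drop supersat x U Q tx few Qbig.
rewrite inE; apply/existsP; exists U; apply/existsP.
have szt : size (map Some s ++ nseq (Q - size s) None) == Q.
  by rewrite size_cat size_map size_nseq subnKC.
exists (Tuple szt).
have -> : pmap id (Tuple szt) = s.
  rewrite /= pmap_cat (_ : pmap _ (nseq _ _) = [::]); last by elim: (Q - _)%N.
  by rewrite cats0 map_pK.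
set C := run x U s in sm ms.
apply/existsP; exists [set u in U | untouched _ _ s u && (x u \in C)].
apply/and4P; split; last 1 first.
- by apply/forallP => u; apply/implyP; rewrite inE => /and3P[].
- set B := [set u in U | _ && (x u \in C)]; set B' := [set u in U | _] in ms.
  have cU : (#|U| <= #|B| + #|B'| + #|[set u : I | ~~ untouched _ m s u]|)%N.
    apply: leq_trans (leq_add (leq_card_setU _ _) (leqnn _)).
    apply: leq_trans (leq_card_setU _ _); apply/subset_leq_card/subsetP => u uU.
    by rewrite !inE uU /=; case: (untouched _ _ _ _); case: (x u \in C); rewrite ?orbT.
  have ms' : (8 * #|B'| <= n)%N by rewrite -(leq_pmul2r V0); lia.
  have ct : (8 * #|[set u : I | ~~ untouched _ m s u]| <= n)%N.
    apply: leq_trans (leq_mul (leqnn 8) (card_touched s)) _.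
    rewrite card_prod card_ord mulnCA mulnC leq_mul2r; apply/orP; right.
    apply: leq_trans few_touched; rewrite -mulnA leq_mul2l /=.
    apply: leq_trans (_ : k * size s <= _)%N; last by rewrite leq_mul2l sz orbT.
    elim: (s) al => [|a s' IH] /=; first by rewrite big_nil.
    by case/andP=> ak /IH h; rewrite big_cons mulnS leq_add // ltnW.
  lia.
- by apply/forallP => u; apply/implyP; rewrite inE => /and3P[].
- exact: ltnW.
Qed.

End UnionBound.

(** * Moments of a uniform random sample *)

Section Moments.
Local Open Scope ring_scope.
Variables (K : realFieldType) (V : finType) (q : nat) (r : K).
Hypothesis V0 : (0 < #|V|)%N.
Hypothesis rE : r * #|V|%:R = q%:R.

Lemma r_ge0 : 0 <= r.
Proof. by rewrite -(@pmulr_lge0 _ #|V|%:R) ?ltr0n // rE. Qed.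

Lemma prod_bool (I : finType) (p : pred I) : \prod_(u : I) (p u)%:R = [forall u, p u]%:R :> K.
Proof.
case: (boolP [forall u, p u]) => [/forallP h|].
  by rewrite big1 // => u _; rewrite h.
by rewrite negb_forall => /existsP[u /negbTE nu]; rewrite (bigD1 u) //= nu mul0r.
Qed.

(** [r] is the probability that a uniform point lies in a given set of q points; distinct
    coordinates are independent. *)
Lemma count_constrained (I : finType) (F : I -> {set V}) (A : {set I}) :
    (forall u, u \in A -> #|F u| = q) ->
  \sum_(x : {ffun I -> V}) [forall u in A, x u \in F u]%:R = #|V|%:R ^+ #|I| * r ^+ #|A|.
Proof.
move=> hF.
transitivity (\sum_(x : {ffun I -> V}) \prod_(u : I) ((u \in A) ==> (x u \in F u))%:R : K).
  by apply: eq_bigr => x _; rewrite prod_bool.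
rewrite -(bigA_distr_bigA (fun u v => ((u \in A) ==> (v \in F u))%:R)).
transitivity (\prod_(u : I) (#|V|%:R * (if u \in A then r else 1))).
  apply: eq_bigr => u _; rewrite -natr_sum sum_bool_card.
  case: (boolP (u \in A)) => uA /=; last by rewrite mulr1 cardsT.
  by rewrite mulrC rE -(hF u uA); congr _%:R; apply: eq_card => v; rewrite inE.
rewrite big_split /= prodr_const; congr (_ * _).
by rewrite -big_mkcond prodr_const.
Qed.

Lemma bernoulli_inv (s : K) n : 0 <= s -> n%:R * s <= 1 / 2 -> (1 + s) ^+ n <= 2.
Proof.
move=> s0 hn.
(* The inductive form; the second factor is at least 1/2. *)
have h : (1 + s) ^+ n * (1 - n%:R * s) <= 1.
  elim: n {hn} => [|n IH]; first by rewrite expr0 mul0r subr0 mul1r.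
  apply: le_trans IH; rewrite exprSr -mulrA ler_wpM2l ?exprn_ge0 ?addr_ge0 //.
  rewrite -natr1; have : 0 <= (n%:R + 1) * s ^+ 2 by rewrite mulr_ge0 ?addr_ge0 ?sqr_ge0.
  set t := n%:R; nra.
have p0 : 0 <= (1 + s) ^+ n by rewrite exprn_ge0 ?addr_ge0.
nra.
Qed.

(** The sum over B factors over indices: 1 + 1 for an index of A, 1 + r for any other, and (1 +
    r)^#|I| <= 2. *)
Lemma sum_subsets_weight (I : finType) (A : {set I}) : #|I|%:R * r <= 1 / 2 ->
  \sum_(B : {set I}) r ^+ #|A :|: B| <= r ^+ #|A| * 2 ^+ #|A|.+1.
Proof.
move=> hr; have r0 := r_ge0.
have -> : \sum_(B : {set I}) r ^+ #|A :|: B| =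
    r ^+ #|A| * \sum_(B : {set I}) \prod_(u : I) (if u \in B then if u \in A then 1 else r else 1).
  rewrite mulr_sumr; apply: eq_bigr => B _.
  have -> : #|A :|: B| = (#|A| + #|B :\: A|)%N.
    by rewrite -(cardsID A (A :|: B)) setUK setDUl setDv set0U.
  rewrite exprD; congr (_ * _); rewrite -prodr_const big_mkcond /=.
  by apply: eq_bigr => u _; rewrite inE; case: (u \in A); case: (u \in B).
rewrite ler_wpM2l ?exprn_ge0 //.
rewrite -(bigA_distr _ _ (fun u => if u \in A then 1 else r) (fun=> 1)) /=.
apply: le_trans (_ : \prod_(u : I) ((if u \in A then 2 else 1) * (1 + r)) <= _).
  apply: ler_prod => u _; case: (u \in A); rewrite ?addr_ge0 //; lra.
rewrite big_split /= -big_mkcond /= !prodr_const exprSr ler_wpM2l ?exprn_ge0 //.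
exact: bernoulli_inv.
Qed.

Variables (L P : finType) (inc : L -> {set V}) (m : nat).
Notation I := (P * 'I_m)%type.
Notation wt_ := (@wt V L P inc m).
Notation n := #|{: I}|.
Hypothesis card_inc : forall l, #|inc l| = q.
Hypothesis n_small : n%:R * r <= 1 / 2.
Hypothesis linear : forall l l', l != l' -> (#|inc l :&: inc l'| <= 1)%N.

Lemma sub_imset_forall (x : {ffun I -> V}) (A : {set I}) l :
  (x @: A \subset inc l) = [forall u in A, x u \in inc l].
Proof.
apply/subsetP/forallP => [h u|h y /imsetP[u uA ->]]; last by have := h u; rewrite uA.
by apply/implyP => uA; apply/h/imset_f.
Qed.

Lemma sum_on_line l (A : {set I}) :
  \sum_(x : {ffun I -> V}) (x @: A \subset inc l)%:R = #|V|%:R ^+ n * r ^+ #|A| :> K.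
Proof.
under eq_bigr => x _ do rewrite sub_imset_forall.
exact: (count_constrained _ (fun=> inc l)).
Qed.

Lemma sum_on_two_lines l l' (A A' : {set I}) : [disjoint A & A'] ->
  \sum_(x : {ffun I -> V}) ((x @: A \subset inc l) && (x @: A' \subset inc l'))%:R
    = #|V|%:R ^+ n * r ^+ (#|A| + #|A'|) :> K.
Proof.
move=> dis; have <- : #|A :|: A'| = (#|A| + #|A'|)%N.
  by rewrite cardsU disjoint_setI0 // cards0 subn0.
rewrite -(count_constrained _ (fun u => if u \in A then inc l else inc l')); last first.
  by move=> u _; case: ifP.
apply: eq_bigr => x _; congr (nat_of_bool _)%:R; rewrite !sub_imset_forall.
apply/andP/forallP => [[/forallP h /forallP h'] u|h].
  by have := h u; have := h' u; rewrite inE; case: (u \in A).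
split; apply/forallP => u; apply/implyP => uA; have := h u; rewrite inE uA ?orbT //=.
by rewrite (disjointFl dis uA).
Qed.

Lemma sum_on_three_lines l1 l2 l3 (A1 A2 A3 : {set I}) :
    [disjoint A1 & A2] -> [disjoint A1 & A3] -> [disjoint A2 & A3] ->
  \sum_(x : {ffun I -> V}) [&& x @: A1 \subset inc l1, x @: A2 \subset inc l2 &
      x @: A3 \subset inc l3]%:R = #|V|%:R ^+ n * r ^+ (#|A1| + #|A2| + #|A3|) :> K.
Proof.
move=> d12 d13 d23; have <- : #|A1 :|: A2 :|: A3| = (#|A1| + #|A2| + #|A3|)%N.
  by rewrite !cardsU setIUl !disjoint_setI0 // setU0 !cards0 !subn0.
rewrite -(count_constrained _ (fun u => if u \in A1 then inc l1 else if u \in A2 then inc l2 else inc l3)); last first.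
  by move=> u _; case: ifP => // _; case: ifP.
apply: eq_bigr => x _; congr (nat_of_bool _)%:R; rewrite !sub_imset_forall.
apply/and3P/forallP => [[/forallP h1 /forallP h2 /forallP h3] u|h].
  have := h1 u; have := h2 u; have := h3 u; rewrite !inE.
  by case: (u \in A1); case: (u \in A2).
split; apply/forallP => u; apply/implyP => uA; have := h u; rewrite !inE uA ?orbT //=.
  by rewrite (disjointFl d12 uA).
by rewrite (disjointFl d13 uA) (disjointFl d23 uA).
Qed.

(** Such a set is the graph of a function from [a] to 'I_m. *)
Lemma card_transversals (a : {set P}) : (0 < m)%N ->
  (#|[set A : {set I} | (parts P m A == a) && (#|A| == #|a|)]| <= m ^ #|a|)%N.
Proof.
move=> m0; pose i0 : 'I_m := Ordinal m0.
have <- : #|pffun_on i0 (mem a) (mem [set: 'I_m])| = (m ^ #|a|)%N.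
  by rewrite card_pffun_on cardsT card_ord.
pose gr (f : {ffun P -> 'I_m}) := [set (p, f p) | p in a].
apply: leq_trans (leq_imset_card gr _); apply/subset_leq_card/subsetP => A.
rewrite inE => /andP[/eqP pA /eqP cA].
have inj : {in A &, injective (fst : I -> P)}.
  by apply/imset_injP; rewrite cA -pA.
pose f := [ffun p => if [pick u in A | u.1 == p] is Some u then u.2 else i0].
have fA u : u \in A -> f u.1 = u.2.
  move=> uA; rewrite ffunE; case: pickP => [w /andP[wA /eqP e]|/(_ u)]; last by rewrite uA eqxx.
  by rewrite (inj w u wA uA e).
apply/imsetP; exists f.
  apply/pffun_onP; split.
    apply/supportP => p pa; rewrite ffunE; case: pickP => // w /andP[wA /eqP e].
    by move: pa; rewrite -pA -e => /negP[]; apply/imset_f.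
  by move=> v _; rewrite inE.
apply/setP => -[p i]; apply/idP/imsetP => [uA|[p' p'a [-> ->]]].
  by exists p; [rewrite -pA; apply/imsetP; exists (p, i)|have /= -> := fA _ uA].
by move: p'a; rewrite -pA => /imsetP[u uA ->]; rewrite (fA _ uA) -surjective_pairing.
Qed.

Lemma pair_on_two_lines (x : {ffun I -> V}) l l' (A A' : {set I}) y : l != l' ->
    y \in inc l -> y \in inc l' -> y \notin x @: A ->
    x @: A \subset inc l -> x @: A' \subset inc l' -> [disjoint A & A'].
Proof.
move=> ne yl yl' yA hA hA'; rewrite disjoints_subset; apply/subsetP => u uA; rewrite inE.
apply/negP => uA'; move: yA; suff -> : y = x u by rewrite imset_f.
have /card_le1_eqP e := linear l l' ne; apply: e; rewrite inE ?yl ?yl' //.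
by rewrite (subsetP hA) ?(subsetP hA') ?imset_f.
Qed.

(** Distinct lines through y share no other point, so their index sets are disjoint and the events
    independent: this gives the square of the mean. Pairs on the same line give the second term. *)
Lemma wt_second_moment (H : nat) (a : {set P}) y : (0 < m)%N ->
    (#|[set l | y \in inc l]| <= H)%N ->
  \sum_(x : {ffun I -> V}) (wt_ x setT setT a y ^ 2)%:R <=
    #|V|%:R ^+ n * ((H%:R * (m%:R * r) ^+ #|a|) ^+ 2 +
       H%:R * ((m%:R * r) ^+ #|a| * 2 ^+ #|a|.+1)).
Proof.
move=> m0 hH; have r0 := r_ge0.
set j := #|a|; set Ly := [set l | y \in inc l].
set Ta := [set A : {set I} | (parts P m A == a) && (#|A| == j)].
pose E (x : {ffun I -> V}) l (A : {set I}) : nat := [&& x @: A \subset inc l & y \notin x @: A].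
have wtE x : (wt_ x setT setT a y <= \sum_(l in Ly) \sum_(A in Ta) E x l A)%N.
  rewrite /wt big_mkcond [leqRHS]big_mkcond; apply: leq_sum => l _; rewrite !inE.
  case: (boolP (y \in inc l)) => yl; last by rewrite big1.
  rewrite [leqRHS]big_mkcond; apply: leq_sum => A _; rewrite subsetT !inE /=.
  case: (parts P m A =P a) => //= pA; rewrite /conf pA.
  by rewrite eq_sym -/j; case: (#|A| == j) => //=; case: (_ == #|A|).
have le1 x : ((wt_ x setT setT a y ^ 2)%:R : K) <=
    \sum_(l in Ly) \sum_(l' in Ly) \sum_(A in Ta) \sum_(A' in Ta) (E x l A * E x l' A')%:R.
  apply: le_trans (_ : ((\sum_(l in Ly) \sum_(A in Ta) E x l A) ^ 2)%:R <= _).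
    by rewrite ler_nat leq_exp2r.
  rewrite expnS expn1 big_distrl /= natr_sum; apply: ler_sum => l _.
  rewrite big_distrr /= natr_sum; apply: ler_sum => l' _.
  rewrite big_distrl /= natr_sum; apply: ler_sum => A _.
  by rewrite big_distrr /= natr_sum.
apply: le_trans (ler_sum _ (fun x _ => le1 x)) _.
set N := #|V|%:R ^+ n; have N0 : 0 <= N by rewrite exprn_ge0.
have cT : #|Ta|%:R <= (m ^ j)%:R :> K by rewrite ler_nat card_transversals.
have cTA A : A \in Ta -> #|A| = j by rewrite inE => /andP[_ /eqP].
have rj0 i : 0 <= r ^+ i by rewrite exprn_ge0.
have same l : \sum_(A in Ta) \sum_(A' in Ta) \sum_(x : {ffun I -> V}) ((E x l A * E x l A')%:R : K) <=
    N * ((m%:R * r) ^+ j * 2 ^+ j.+1).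
  apply: le_trans (_ : \sum_(A in Ta) N * (r ^+ j * 2 ^+ j.+1) <= _).
    apply: ler_sum => A /cTA cA.
    apply: le_trans (_ : \sum_(A' : {set I}) N * r ^+ #|A :|: A'| <= _).
      rewrite big_mkcond; apply: ler_sum => A' _; case: ifP => _; last by rewrite mulr_ge0.
      rewrite -(sum_on_line l); apply: ler_sum => x _; rewrite ler_nat imsetU subUset /E.
      by case: (x @: A \subset _); case: (x @: A' \subset _); case: (y \notin x @: A);
        case: (y \notin x @: A').
    rewrite -mulr_sumr ler_wpM2l // -[in leRHS]cA; exact: sum_subsets_weight.
  rewrite sumr_const -[leLHS]mulr_natl [leLHS]mulrCA ler_wpM2l //.
  have -> : (m%:R * r) ^+ j * 2 ^+ j.+1 = (m ^ j)%:R * (r ^+ j * 2 ^+ j.+1).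
    by rewrite exprMn natrX mulrA.
  by rewrite ler_wpM2r // mulr_ge0 // exprn_ge0.
have diff l l' : l \in Ly -> l' \in Ly -> l != l' ->
    \sum_(A in Ta) \sum_(A' in Ta) \sum_(x : {ffun I -> V}) ((E x l A * E x l' A')%:R : K) <=
    N * ((m%:R * r) ^+ j) ^+ 2.
  rewrite !inE => yl yl' ne.
  apply: le_trans (_ : \sum_(A in Ta) \sum_(A' in Ta) N * r ^+ (j + j) <= _).
    apply: ler_sum => A /cTA cA; apply: ler_sum => A' /cTA cA'.
    case: (boolP [disjoint A & A']) => dis.
      rewrite -[X in (X + _)%N]cA -[X in (_ + X)%N]cA' -(sum_on_two_lines l l' A A' dis).
      apply: ler_sum => x _; rewrite ler_nat /E.
      by case: (x @: A \subset _); case: (x @: A' \subset _); case: (y \notin x @: A);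
        case: (y \notin x @: A').
    rewrite big1 ?mulr_ge0 // => x _; rewrite /E.
    case h1: (x @: A \subset inc l); rewrite ?mul0n //.
    case h2: (y \notin x @: A); rewrite ?mul0n //.
    case h3: (x @: A' \subset inc l'); rewrite ?muln0 //.
    by rewrite (pair_on_two_lines x l l' A A' y) in dis.
  under eq_bigr => A _ do rewrite sumr_const -mulr_natl.
  rewrite sumr_const -[leLHS]mulr_natl.
  have -> : N * ((m%:R * r) ^+ j) ^+ 2 = (m ^ j)%:R * ((m ^ j)%:R * (N * r ^+ (j + j))).
    by rewrite exprMn natrX exprD; ring.
  have Nr : 0 <= N * r ^+ (j + j) by rewrite mulr_ge0.
  by apply: ler_pM; rewrite ?mulr_ge0 // ler_wpM2r.
have -> : \sum_(x : {ffun I -> V}) \sum_(l in Ly) \sum_(l' in Ly) \sum_(A in Ta) \sum_(A' in Ta)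
     ((E x l A * E x l' A')%:R : K) =
   \sum_(l in Ly) \sum_(l' in Ly) \sum_(A in Ta) \sum_(A' in Ta) \sum_(x : {ffun I -> V})
     ((E x l A * E x l' A')%:R : K).
  rewrite exchange_big; apply: eq_bigr => l _.
  rewrite exchange_big; apply: eq_bigr => l' _.
  by rewrite exchange_big; apply: eq_bigr => A _; rewrite exchange_big.
have mr0 i : 0 <= (m%:R * r) ^+ i by rewrite exprn_ge0 // mulr_ge0.
set s := N * ((m%:R * r) ^+ j * 2 ^+ j.+1) in same; set d := N * ((m%:R * r) ^+ j) ^+ 2 in diff.
have s0 : 0 <= s by rewrite !mulr_ge0 // exprn_ge0.
have d0 : 0 <= d by rewrite mulr_ge0 // exprn_ge0.
apply: le_trans (_ : \sum_(l in Ly) (s + H%:R * d) <= _).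
  apply: ler_sum => l lL; rewrite (bigD1 l) //=; apply: lerD => //.
  apply: le_trans (_ : \sum_(l' in Ly | l' != l) d <= _).
    by apply: ler_sum => l' /andP[l'L ne]; apply: diff => //; rewrite eq_sym.
  rewrite sumr_const -[leLHS]mulr_natl ler_wpM2r // ler_nat; apply: leq_trans hH.
  by apply: subset_leq_card; apply/subsetP => l'; rewrite unfold_in => /andP[].
rewrite sumr_const -[leLHS]mulr_natl.
apply: le_trans (_ : H%:R * (s + H%:R * d) <= _).
  by rewrite ler_wpM2r ?ler_nat // addr_ge0 // mulr_ge0.
by rewrite le_eqVlt; apply/orP; left; apply/eqP; rewrite /s /d; ring.
Qed.

End Moments.

(** * Markov's inequality for counting *)

Section Markov.
Local Open Scope ring_scope.

Lemma markov_count (K : realFieldType) (X : finType) (f : X -> K) (e c : K) :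
    (forall x, 0 <= f x) -> 0 < e -> 0 < c -> \sum_x f x <= #|X|%:R * e ->
  c * #|[set x | c * e < f x]|%:R <= #|X|%:R.
Proof.
move=> f0 e0 c0 h; rewrite -(ler_pM2r e0); apply: le_trans h.
rewrite mulrAC mulr_natr -sumr_const big_mkcond.
by apply: ler_sum => x _; rewrite inE; case: ifP => [/ltW|].
Qed.

End Markov.

(** * A sample with many rich lines defeats every small net *)

Section MissedLine.
Variables (V L P : finType) (inc : L -> {set V}) (m k : nat) (Tri : {set L * L * L}).
Notation I := (P * 'I_m)%type.
Notation n := #|{: I}|.
Implicit Types (x : {ffun I -> V}).

Definition lconf x (U : {set I}) l : nat := \sum_(A : {set I}) ([&& A \subset U, #|A| == k & conf V L P inc m x A l] : nat).

Definition collisions x : nat := \sum_(u : I) \sum_(u' : I) ((u != u') && (x u == x u') : nat).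

(** Disjointness makes the three events independent. It costs nothing later, because [unhit] forces
    it on lines hit by a common net point. *)
Definition triple_confs x : nat :=
  \sum_(p in Tri) \sum_(A1 in [set A : {set I} | #|A| == k])
    \sum_(A2 in [set A : {set I} | #|A| == k]) \sum_(A3 in [set A : {set I} | #|A| == k])
  ([&& [disjoint A1 & A2], [disjoint A1 & A3], [disjoint A2 & A3],
     x @: A1 \subset inc p.1.1, x @: A2 \subset inc p.1.2 & x @: A3 \subset inc p.2] : nat).

Lemma nconf_lconf x U : nconf V L P inc m x U setT k = \sum_l lconf x U l.
Proof. by apply: eq_bigl => l; rewrite inE. Qed.

Lemma lconf_mono x U l : lconf x U l <= lconf x setT l.
Proof. by apply: leq_sum => A _; rewrite subsetT; case: (A \subset U). Qed.

(* [z t] is the point of [V] at the position of the [t]-th point of the net, if there is one. *)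
Variables (x : {ffun I -> V}) (tau : nat) (hit : 'I_tau -> L -> bool) (z : 'I_tau -> option V).
Hypothesis hit2 : forall t l l' y, l != l' -> hit t l -> hit t l' ->
  y \in inc l -> y \in inc l' -> z t = Some y.
Hypothesis hit3 : forall t l1 l2 l3, hit t l1 -> hit t l2 -> hit t l3 ->
  l1 != l2 -> l1 != l3 -> l2 != l3 -> (l1, l2, l3) \in Tri.

Definition unhit := [set u : I | [forall t, z t != Some (x u)]].

(** Apart from colliding indices, sample points are distinct, so each net point spoils at most one
    index. *)
Lemma card_unhit : 2 * (tau + collisions x) <= n -> n <= 2 * #|unhit|.
Proof.
move=> h; suff : #|~: unhit| <= tau + collisions x by have e : #|unhit| + #|~: unhit| = n := cardsC unhit; lia.
pose Co := [set u : I | [exists u', (u != u') && (x u == x u')]].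
have cCo : #|Co| <= collisions x.
  rewrite -sum1_card big_mkcond; apply: leq_sum => u _; rewrite inE.
  by case: ifP => // /existsP[u' hu]; rewrite (bigD1 u') //= hu.
rewrite -(cardsID Co) addnC; apply: leq_add; last first.
  by apply: leq_trans cCo; apply/subset_leq_card/subsetIr.
set D := _ :\: Co; rewrite -[leqRHS]card_ord.
have [u0 u0D|/eq_card0 ->//] := pickP (mem D).
have ex u : u \in D -> {t | z t = Some (x u)}.
  rewrite !inE negb_forall => /andP[_ /existsP h']; exists (xchoose h').
  by apply/eqP; have := xchooseP h'; rewrite negbK.
pose f u := match boolP (u \in D) with AltTrue p => sval (ex u p) | AltFalse _ => sval (ex u0 u0D) end.
have fP u : u \in D -> z (f u) = Some (x u).
  by move=> uD; rewrite /f; case: {-}_ / boolP => [p|/negP//]; case: (ex u p).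
rewrite -(@card_in_imset _ _ f D) ?max_card // => u w uD wD e.
have : Some (x u) = Some (x w) by rewrite -fP // e fP.
case=> exw; apply/eqP; move: uD; rewrite !inE => /andP[/existsP nC _].
by apply/negPn/negP => ne; apply: nC; exists w; rewrite ne exw eqxx.
Qed.

(** Otherwise every rich line is charged to one net point hitting it. A net point charged with at
    most two lines pays through c <= X + c^2 / X; one charged with three or more pays through
    concurrent triples. *)
Lemma exists_missed_line (K : realFieldType) (X : K) : (0 < X)%R ->
    ((2 * X * tau%:R + (\sum_l lconf x setT l ^ 2)%:R / X + (triple_confs x)%:R) <
       (nconf V L P inc m x unhit setT k)%:R)%R ->
  exists l, (exists2 A : {set I}, #|A| = k & conf V L P inc m x A l) /\ forall t, ~~ hit t l.
Proof.
move=> X0; rewrite nconf_lconf.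
pose c l := lconf x unhit l.
case: (boolP [exists l, (0 < c l) && [forall t, ~~ hit t l]]).
  case/existsP=> l /andP[cl /forallP nh] _; exists l; split => //.
  move: cl; rewrite lt0n sum_nat_eq0 negb_forall => /existsP[A].
  by rewrite negb_imply /= eqb0 negbK => /and3P[_ /eqP cA cf]; exists A.
rewrite negb_exists => /forallP hitall; rewrite ltNge => /negP[].
pose own l := [pick t | (0 < c l) && hit t l].
have ownP l : 0 < c l -> exists2 t, own l = Some t & hit t l.
  move=> cl; rewrite /own; case: pickP => [t /andP[_ h]|no]; first by exists t.
  have := hitall l; rewrite cl /= negb_forall => /existsP[t]; rewrite negbK => h.
  by have := no t; rewrite cl h.
have own0 l t : own l = Some t -> hit t l /\ 0 < c l.
  by rewrite /own; case: pickP => // t' /andP[h0 h] [<-].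
pose G t := [set l | own l == Some t].
pose T3 t := \sum_(l1 in G t) \sum_(l2 in G t) \sum_(l3 in G t)
   ([&& l1 != l2, l1 != l3 & l2 != l3] * (c l1 * c l2 * c l3)).
have cG t l : l \in G t -> 0 < c l by rewrite inE => /eqP/own0[].
have sumc : \sum_l c l = \sum_t \sum_(l in G t) c l.
  rewrite (eq_bigr (fun l => \sum_t (l \in G t) * c l)) => [|l _].
    rewrite exchange_big; apply: eq_bigr => t _; rewrite [RHS]big_mkcond.
    by apply: eq_bigr => l _; case: (l \in G t); rewrite ?mul1n.
  case: (posnP (c l)) => [->|cl]; first by rewrite big1 // => t _; rewrite muln0.
  have [t e _] := ownP l cl; rewrite (bigD1 t) //= inE e eqxx mul1n big1 ?addn0 // => t' ne.
  by rewrite inE e; case: eqP => // -[e']; rewrite e' eqxx in ne.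
have sumc2 : \sum_t \sum_(l in G t) c l ^ 2 <= \sum_l lconf x setT l ^ 2.
  rewrite (eq_bigr (fun t => \sum_l (l \in G t) * c l ^ 2)) => [|t _]; last first.
    by rewrite big_mkcond; apply: eq_bigr => l _; case: (l \in G t); rewrite ?mul1n.
  rewrite exchange_big; apply: leq_sum => l _.
  apply: leq_trans (_ : c l ^ 2 <= _); last by rewrite leq_exp2r // lconf_mono.
  case e: (own l) => [t|]; last by rewrite big1 // => t _; rewrite inE e.
  rewrite (bigD1 t) //= inE e eqxx mul1n big1 ?addn0 // => t' ne.
  by rewrite inE e; case: eqP => // -[e']; rewrite e' eqxx in ne.
(* Every l1 has two further lines in its group, and their counts are positive, so c l1 is at most a
   product of three counts. *)
have large t : 3 <= #|G t| -> \sum_(l in G t) c l <= T3 t.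
  move=> h3; apply: leq_sum => l1 l1G.
  have /card_gt0P[l2] : 0 < #|G t :\ l1| by have := cardsD1 l1 (G t); rewrite l1G; lia.
  rewrite !inE => /andP[n21 l2G].
  have /card_gt0P[l3] : 0 < #|G t :\ l1 :\ l2|.
    have := cardsD1 l1 (G t); have := cardsD1 l2 (G t :\ l1).
    by rewrite l1G !inE n21 l2G; lia.
  rewrite !inE => /and3P[n32 n31 l3G].
  rewrite (bigD1 l2) ?inE //= (bigD1 l3) ?inE //= (eq_sym l1 l2) (eq_sym l1 l3) (eq_sym l2 l3) n21 n31 n32 mul1n.
  have := cG t l2; have := cG t l3; rewrite !inE l2G l3G => /(_ isT) c3 /(_ isT) c2.
  rewrite -!addnA -mulnA; apply: leq_trans (leq_addr _ _); rewrite leq_pmulr // muln_gt0 c2 c3 //.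
have small t : #|G t| <= 2 -> ((\sum_(l in G t) c l)%:R <= 2 * X + (\sum_(l in G t) c l ^ 2)%:R / X :> K)%R.
  move=> h2; apply: (@le_trans _ _ (\sum_(l in G t) (X + (c l)%:R ^+ 2 / X)))%R.
    rewrite natr_sum; apply: ler_sum => l _; set a : K := (c l)%:R%R.
    rewrite -(ler_pM2r X0) mulrDl divfK ?gt_eqF //.
    have : (0 <= a)%R by []. have : (0 <= (X - a) ^+ 2)%R by exact: sqr_ge0. nra.
  rewrite big_split /= sumr_const -mulr_suml -[X in (X + _)%R]mulr_natl natr_sum.
  apply: lerD; first by rewrite ler_pM2r // ler_nat.
  by rewrite le_eqVlt; apply/orP; left; apply/eqP; congr (_ * _)%R; apply: eq_bigr => l _; rewrite natrX.
have T3le : \sum_t T3 t <= triple_confs x.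
  pose Sk := [set A : {set I} | #|A| == k].
  pose F l1 l2 l3 := \sum_(A1 in Sk) \sum_(A2 in Sk) \sum_(A3 in Sk)
    ([&& [disjoint A1 & A2], [disjoint A1 & A3], [disjoint A2 & A3],
     x @: A1 \subset inc l1, x @: A2 \subset inc l2 & x @: A3 \subset inc l3] : nat).
  have cE l : c l <= \sum_(A in Sk) ((A \subset unhit) && (x @: A \subset inc l) : nat).
    rewrite [leqRHS]big_mkcond; apply: leq_sum => A _; rewrite inE /conf.
    by case: (A \subset unhit); case: (#|A| == k) => //=; case: (x @: A \subset inc l); rewrite ?andbF ?leq_b1.
  have disj t l l' (A A' : {set I}) : l \in G t -> l' \in G t -> l != l' -> A \subset unhit ->
      x @: A \subset inc l -> x @: A' \subset inc l' -> [disjoint A & A'].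
    rewrite !inE => /eqP/own0[h _] /eqP/own0[h' _] ne sA hA hA'.
    rewrite disjoints_subset; apply/subsetP => u uA; rewrite inE; apply/negP => uA'.
    have := subsetP sA u uA; rewrite inE => /forallP/(_ t)/eqP; apply.
    by apply: (hit2 t l l') => //; [apply: (subsetP hA)|apply: (subsetP hA')]; apply: imset_f.
  have cccF t l1 l2 l3 : l1 \in G t -> l2 \in G t -> l3 \in G t ->
      l1 != l2 -> l1 != l3 -> l2 != l3 -> c l1 * c l2 * c l3 <= F l1 l2 l3.
    move=> h1 h2 h3 n12 n13 n23.
    apply: leq_trans (leq_mul (leq_mul (cE l1) (cE l2)) (cE l3)) _.
    rewrite -mulnA big_distrl; apply: leq_sum => A1 _ /=.
    rewrite mulnA [X in X * _ <= _]big_distrr /= big_distrl; apply: leq_sum => A2 _ /=.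
    rewrite big_distrr; apply: leq_sum => A3 _ /=.
    case: (boolP (A1 \subset unhit)) => // s1; case: (boolP (A2 \subset unhit)) => // s2;
      rewrite /= ?muln0 //; case: (boolP (A3 \subset unhit)) => // s3; rewrite /= ?muln0 //.
    case: (boolP (x @: A1 \subset _)) => // i1; case: (boolP (x @: A2 \subset _)) => // i2;
      rewrite ?muln0 //; case: (boolP (x @: A3 \subset _)) => // i3; rewrite ?muln0 //.
    by rewrite (disj t l1 l2) // (disj t l1 l3) // (disj t l2 l3).
  have -> : triple_confs x = \sum_l1 \sum_l2 \sum_l3 ((l1, l2, l3) \in Tri) * F l1 l2 l3.
    rewrite !pair_big /= /triple_confs big_mkcond; apply: eq_bigr => -[[l1 l2] l3] _ /=.
    by case: ifP; rewrite ?mul1n ?mul0n.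
  apply: leq_trans (_ : \sum_t \sum_l1 (l1 \in G t) *
      \sum_l2 \sum_l3 ((l1, l2, l3) \in Tri) * F l1 l2 l3 <= _).
    apply: leq_sum => t _; rewrite /T3 big_mkcond; apply: leq_sum => l1 _.
    case: ifP => // h1; rewrite mul1n big_mkcond; apply: leq_sum => l2 _.
    case: ifP => // h2; rewrite big_mkcond; apply: leq_sum => l3 _.
    case: ifP => // h3; case: (boolP [&& _, _ & _]) => // /and3P[n12 n13 n23].
    have [e1 _] := own0 l1 t (eqP (etrans (esym (in_set _ _)) h1)).
    have [e2 _] := own0 l2 t (eqP (etrans (esym (in_set _ _)) h2)).
    have [e3 _] := own0 l3 t (eqP (etrans (esym (in_set _ _)) h3)).
    by rewrite (hit3 t) // !mul1n (cccF t).
  rewrite exchange_big; apply: leq_sum => l1 _ /=; rewrite -big_distrl /=.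
  rewrite -[leqRHS]mul1n leq_mul2r; apply/orP; right.
  case e: (own l1) => [t|]; last by rewrite big1 // => t _; rewrite inE e.
  rewrite (bigD1 t) //= inE e eqxx big1 // => t' ne.
  by rewrite inE e; case: eqP => // -[e']; rewrite e' eqxx in ne.
have each t : ((\sum_(l in G t) c l)%:R <= 2 * X + (\sum_(l in G t) c l ^ 2)%:R / X + (T3 t)%:R :> K)%R.
  case: (leqP #|G t| 2) => h.
    by apply: le_trans (small t h) _; rewrite lerDl.
  apply: (@le_trans _ _ (T3 t)%:R%R); first by rewrite ler_nat large.
  rewrite lerDr; apply: addr_ge0; first by rewrite mulr_ge0 // ltW.
  by rewrite divr_ge0 // ltW.
rewrite sumc natr_sum; apply: le_trans (ler_sum _ (fun t _ => each t)) _.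
rewrite !big_split /= sumr_const card_ord -mulr_suml -!natr_sum -[X in (X + _ + _)%R]mulr_natr.
apply: lerD; last by rewrite ler_nat.
by rewrite lerD2l ler_pM2r ?invr_gt0 // ler_nat.
Qed.

End MissedLine.

(** * Expected values of the statistics of a sample *)

Section GoodSample.
Local Open Scope ring_scope.
Variables (K : realFieldType) (V L P : finType) (inc : L -> {set V}) (m k q H : nat) (r : K).
Variable Tri : {set L * L * L}.
Notation I := (P * 'I_m)%type.
Notation n := #|{: I}|.
Notation X := {ffun I -> V}.
Hypothesis V0 : (0 < #|V|)%N.
Hypothesis rE : r * #|V|%:R = q%:R.
Hypothesis card_inc : forall l, #|inc l| = q.
Hypothesis n_small : n%:R * r <= 1 / 2.
Hypothesis linear : forall l l', l != l' -> (#|inc l :&: inc l'| <= 1)%N.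
Hypothesis degree : forall y, (#|[set l | y \in inc l]| <= H)%N.
Hypothesis m0 : (0 < m)%N.

Let r0 : 0 <= r := r_ge0 K V q r V0 rE.

Lemma card_samples : #|{: X}|%:R = #|V|%:R ^+ n :> K.
Proof. by rewrite card_ffun natrX. Qed.

Lemma tame_moment j :
  \sum_(x : X) \sum_(a in [set a : {set P} | #|a| == j]) \sum_(y : V)
     ((wt V L P inc m x setT setT a y) ^ 2)%:R <=
  #|{: X}|%:R * ((#|P| ^ j)%:R * (#|V|%:R *
     ((H%:R * (m%:R * r) ^+ j) ^+ 2 + H%:R * ((m%:R * r) ^+ j * 2 ^+ j.+1)))).
Proof.
rewrite card_samples; set N := _ ^+ n; set e := _ + _.
have e0 : 0 <= e.
  have h : 0 <= (m%:R * r) ^+ j by rewrite exprn_ge0 // mulr_ge0.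
  by rewrite addr_ge0 ?sqr_ge0 // !mulr_ge0 // exprn_ge0.
have N0 : 0 <= N by rewrite exprn_ge0.
rewrite exchange_big /=.
apply: le_trans (_ : \sum_(a in [set a : {set P} | #|a| == j]) \sum_(y : V) N * e <= _).
  apply: ler_sum => a; rewrite inE => /eqP ca; rewrite exchange_big; apply: ler_sum => y _.
  have := wt_second_moment K V q r V0 rE L P inc m card_inc n_small linear H a y m0 (degree y).
  by rewrite ca.
have -> : \sum_(a in [set a : {set P} | #|a| == j]) \sum_(y : V) N * e =
   #|[set a : {set P} | #|a| == j]|%:R * (#|V|%:R * (N * e)).
  rewrite (eq_bigr (fun=> #|V|%:R * (N * e))) => [|a _]; first by rewrite sumr_const -[LHS]mulr_natl.
  by rewrite sumr_const -[LHS]mulr_natl.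
have -> : N * ((#|P| ^ j)%:R * (#|V|%:R * e)) = (#|P| ^ j)%:R * (#|V|%:R * (N * e)) by ring.
by rewrite ler_wpM2r ?ler_nat ?card_sets_of_size // !mulr_ge0.
Qed.

Lemma lconf_moment :
  \sum_(x : X) (\sum_l lconf V L P inc m k x setT l ^ 2)%:R <=
  #|{: X}|%:R * (#|L|%:R * ((n%:R * r) ^+ k * 2 ^+ k.+1)).
Proof.
rewrite card_samples; set N := _ ^+ n.
have N0 : 0 <= N by rewrite exprn_ge0.
under eq_bigr => x _ do rewrite natr_sum.
rewrite exchange_big /=.
have -> : N * (#|L|%:R * ((n%:R * r) ^+ k * 2 ^+ k.+1)) =
   \sum_(l : L) (N * ((n ^ k)%:R * (r ^+ k * 2 ^+ k.+1))).
  by rewrite sumr_const -[RHS]mulr_natl exprMn natrX; ring.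
apply: ler_sum => l _; pose Sk := [set A : {set I} | #|A| == k].
apply: le_trans (_ : \sum_(A in Sk) N * (r ^+ k * 2 ^+ k.+1) <= _); last first.
  rewrite sumr_const -[leLHS]mulr_natl [leLHS]mulrCA ler_wpM2l // ler_wpM2r //.
    by rewrite mulr_ge0 ?exprn_ge0.
  by rewrite ler_nat card_sets_of_size.
(* One factor of the square is enlarged to all subsets A', so that [sum_subsets_weight] applies. *)
apply: (@le_trans _ _ (\sum_(x : X) \sum_(A in Sk) \sum_(A' : {set I})
    (x @: (A :|: A') \subset inc l)%:R)).
  apply: ler_sum => x _.
  apply: le_trans (_ : ((\sum_(A in Sk) (x @: A \subset inc l)) *
      (\sum_(A' : {set I}) (x @: A' \subset inc l)))%:R <= _).
    rewrite ler_nat expnS expn1; apply: leq_mul.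
      rewrite [leqRHS]big_mkcond; apply: leq_sum => A _; rewrite subsetT inE /conf /=.
      by case: (#|A| == k) => //=; case: (x @: A \subset inc l); rewrite ?andbF ?leq_b1.
    apply: leq_sum => A _; rewrite subsetT /conf /=.
    by case: (x @: A \subset inc l); rewrite ?andbF ?leq_b1.
  rewrite big_distrl /= natr_sum; apply: ler_sum => A _.
  rewrite big_distrr /= natr_sum; apply: ler_sum => A' _.
  by rewrite ler_nat imsetU subUset; case: (x @: A \subset _); case: (x @: A' \subset _).
rewrite exchange_big; apply: ler_sum => A; rewrite inE => /eqP cA.
rewrite exchange_big /= (eq_bigr (fun A' => N * r ^+ #|A :|: A'|)) => [|A' _]; last first.
  by rewrite (sum_on_line K V q r rE L P inc m card_inc l).
rewrite -mulr_sumr ler_wpM2l // -cA; exact: (sum_subsets_weight K V q r V0 rE).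
Qed.

Lemma triple_moment :
  \sum_(x : X) (triple_confs V L P inc m k Tri x)%:R <=
  #|{: X}|%:R * (#|Tri|%:R * ((n%:R * r) ^+ k) ^+ 3).
Proof.
rewrite card_samples; set N := _ ^+ n.
have N0 : 0 <= N by rewrite exprn_ge0.
pose Sk := [set A : {set I} | #|A| == k].
rewrite (eq_bigr (fun x : X => \sum_(p in Tri) \sum_(A1 in Sk) \sum_(A2 in Sk) \sum_(A3 in Sk)
  ([&& [disjoint A1 & A2], [disjoint A1 & A3], [disjoint A2 & A3],
     x @: A1 \subset inc p.1.1, x @: A2 \subset inc p.1.2 & x @: A3 \subset inc p.2]%:R : K)));
  last first.
  move=> x _; rewrite natr_sum; apply: eq_bigr => p _; rewrite natr_sum; apply: eq_bigr => A1 _.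
  by rewrite natr_sum; apply: eq_bigr => A2 _; rewrite natr_sum.
rewrite exchange_big /=.
have -> : N * (#|Tri|%:R * ((n%:R * r) ^+ k) ^+ 3) =
   \sum_(p in Tri) ((n ^ k)%:R * ((n ^ k)%:R * ((n ^ k)%:R * (N * r ^+ (k + k + k))))).
  by rewrite sumr_const -[RHS]mulr_natl exprMn natrX !exprD; ring.
apply: ler_sum => p _; rewrite exchange_big /=.
have Nr : 0 <= N * r ^+ (k + k + k) by rewrite mulr_ge0 ?exprn_ge0.
have cS : #|Sk|%:R <= (n ^ k)%:R :> K by rewrite ler_nat card_sets_of_size.
have bnd (f : {set I} -> K) c : 0 <= c -> (forall A, A \in Sk -> f A <= c) ->
    \sum_(A in Sk) f A <= (n ^ k)%:R * c.
  move=> c0 h; apply: le_trans (ler_sum _ h) _.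
  by rewrite sumr_const -[leLHS]mulr_natl ler_wpM2r.
apply: (bnd) => [|A1]; first by do 2!(apply: mulr_ge0 => //).
rewrite inE => /eqP c1; rewrite exchange_big /=.
apply: (bnd) => [|A2]; first by apply: mulr_ge0.
rewrite inE => /eqP c2; rewrite exchange_big /=.
apply: (bnd) => [|A3]; first by [].
rewrite inE => /eqP c3.
case: (boolP [&& [disjoint A1 & A2], [disjoint A1 & A3] & [disjoint A2 & A3]]) => d; last first.
  rewrite big1 // => x _; move: d; rewrite !negb_and.
  by case: [disjoint A1 & A2] => //=; case: [disjoint A1 & A3] => //=; case: [disjoint A2 & A3].
case/and3P: d => d12 d13 d23.
have := sum_on_three_lines K V q r rE L P inc m card_inc p.1.1 p.1.2 p.2 A1 A2 A3 d12 d13 d23.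
rewrite c1 c2 c3 => <-; rewrite le_eqVlt; apply/orP; left; apply/eqP.
by apply: eq_bigr => x _; rewrite d12 d13 d23.
Qed.

Lemma collision_moment :
  \sum_(x : X) (collisions V P m x)%:R <= #|{: X}|%:R * (n%:R ^+ 2 / #|V|%:R) :> K.
Proof.
rewrite card_samples; set N := _ ^+ n.
have vn : #|V|%:R != 0 :> K by rewrite pnatr_eq0 -lt0n.
have N0 : 0 <= N by rewrite exprn_ge0.
have c0 : 0 <= N / #|V|%:R by rewrite divr_ge0.
rewrite (eq_bigr (fun x : X => \sum_(u : I) \sum_(u' : I) (((u != u') && (x u == x u'))%:R : K))); last first.
  by move=> x _; rewrite natr_sum; apply: eq_bigr => u _; rewrite natr_sum.
rewrite exchange_big /=.
have -> : N * (n%:R ^+ 2 / #|V|%:R) = \sum_(u : I) \sum_(u' : I) N / #|V|%:R.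
  rewrite (eq_bigr (fun=> n%:R * (N / #|V|%:R))) => [|u _].
    by rewrite sumr_const -[RHS]mulr_natl; ring.
  by rewrite sumr_const -[LHS]mulr_natl.
apply: ler_sum => u _; rewrite exchange_big; apply: ler_sum => u' _ /=.
case: (boolP (u != u')) => ne /=; last by rewrite big1.
have e1 : #|V|%:R^-1 * #|V|%:R = 1%:R :> K by rewrite mulVf.
(* A collision is split by its common value v: two coordinates constrained to a singleton, the case
   q = 1 of [count_constrained]. *)
rewrite (eq_bigr (fun x : X => \sum_(v : V) [forall w in [set u; u'], x w \in [set v]]%:R)).
  rewrite exchange_big /= (eq_bigr (fun=> N * #|V|%:R^-1 ^+ 2)) => [|v _]; last first.
    rewrite (count_constrained K V 1 _ e1 _ (fun=> [set v])) => [|w _]; last by rewrite cards1.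
    by rewrite cards2 ne.
  by rewrite sumr_const -[leLHS]mulr_natr expr2 -!mulrA mulVf // mulr1.
move=> x _; case: eqP => [e|ne'].
  rewrite (bigD1 (x u)) //= big1 ?addr0 => [|v nv].
    case: (boolP [forall _ in _, _]) => // /forallP[] w; apply/implyP.
    by rewrite !inE => /orP[]/eqP-> //; rewrite e.
  case: (boolP [forall _ in _, _]) => // /forallP/(_ u); rewrite !inE eqxx /= => /eqP ev.
  by rewrite ev eqxx in nv.
rewrite big1 // => v _; case: (boolP [forall _ in _, _]) => // /forallP h.
have := h u; have := h u'; rewrite !inE !eqxx orbT /= => /eqP e1' /eqP e2'.
by case: ne'; rewrite e1' e2'.
Qed.

End GoodSample.

(** * Existence of one sample with all required properties *)

Section Existence.
Local Open Scope ring_scope.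
Variables (K : realFieldType) (V L P : finType) (inc : L -> {set V}) (m k q H : nat) (r : K).
Variable Tri : {set L * L * L}.
Notation I := (P * 'I_m)%type.
Notation n := #|{: I}|.
Notation X := {ffun I -> V}.
Hypothesis k0 : (0 < k)%N.
Hypothesis V0 : (0 < #|V|)%N.
Hypothesis rE : r * #|V|%:R = q%:R.
Hypothesis card_inc : forall l, #|inc l| = q.
Hypothesis n_small : n%:R * r <= 1 / 2.
Hypothesis linear : forall l l', l != l' -> (#|inc l :&: inc l'| <= 1)%N.
Hypothesis degree : forall y, (#|[set l | y \in inc l]| <= H)%N.
Hypothesis m0 : (0 < m)%N.
Variables (kp th D : nat -> K) (gam Xc S2 S3 : K) (De Q b : nat).
Hypothesis gam0 : 0 < gam.
Hypothesis kp0 : forall j, 0 < kp j.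
Hypothesis th0 : forall j, 0 < th j.
Hypothesis D0 : forall j, 0 < D j.
Hypothesis kp_small : forall j, (j < k)%N -> 4 * (#|P| ^ j)%:R * kp j * #|V|%:R <= th j.
Hypothesis gam_small : forall j, (j < k)%N ->
  16 * D j * (#|P| ^ j)%:R * (gam * #|V|%:R) <= th j ^+ 2.
Hypothesis th_drop : forall j, (j < k)%N ->
  16 * (k%:R * th j.+1) * D j * (8 * #|V|%:R) <= kp j * th j ^+ 2 * n%:R.
Hypothesis supersat : forall C : {set V}, (#|V| <= De * #|C|)%N ->
  th 0 <= #|rich _ _ inc k C|%:R.
Hypothesis Qbig : 1 < gam * Q%:R.
Hypothesis few_touched : (8 * k * Q <= #|P|)%N.
Hypothesis b_small : (4 * b <= n)%N.
Hypothesis D_big : forall j, (j < k)%N ->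
  4 * k%:R * ((#|P| ^ j)%:R * (#|V|%:R *
     ((H%:R * (m%:R * r) ^+ j) ^+ 2 + H%:R * ((m%:R * r) ^+ j * 2 ^+ j.+1)))) <= D j.
Hypothesis De_big : (8 * 2 ^ (n + #|P|.+1 * Q + n) <= De ^ b)%N.
Hypothesis V_big : (64 * n <= #|V|)%N.
Hypothesis S2_big : 8 * (#|L|%:R * ((n%:R * r) ^+ k * 2 ^+ k.+1)) <= S2.
Hypothesis S3_big : 8 * (#|Tri|%:R * ((n%:R * r) ^+ k) ^+ 3) <= S3.
Hypothesis S20 : 0 < S2.
Hypothesis S30 : 0 < S3.
Hypothesis Xc0 : 0 < Xc.
Hypothesis n0 : (0 < n)%N.
Hypothesis th_big : 2 * Xc * n%:R + S2 / Xc + S3 < th k.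

Lemma card_bigcup_le (T J : finType) (F : J -> {set T}) : (#|\bigcup_j F j| <= \sum_j #|F j|)%N.
Proof.
elim/big_rec2: _ => [|j S c _ IH]; first by rewrite cards0.
by apply: leq_trans (leq_card_setU _ _) _; rewrite leq_add2l.
Qed.

(** The five failure events have total probability at most 1/4 + 4/8 < 1. *)
Lemma exists_good_sample : exists x : X,
  [/\ tame K V L P inc m k D x, x \notin captured K V L P inc m k kp De Q b,
    (\sum_l lconf V L P inc m k x setT l ^ 2)%:R <= S2,
    (triple_confs V L P inc m k Tri x)%:R <= S3 & (8 * collisions V P m x <= n)%N].
Proof.
have k0' : 0 < k%:R :> K by rewrite ltr0n.
have v0 : 0 < #|V|%:R :> K by rewrite ltr0n.
pose f1 j (x : X) : K := \sum_(a in [set a : {set P} | #|a| == j]) \sum_(y : V)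
     ((wt V L P inc m x setT setT a y) ^ 2)%:R.
pose B1 := \bigcup_(j : 'I_k) [set x : X | D j < f1 j x].
pose B2 := [set x : X | S2 < (\sum_l lconf V L P inc m k x setT l ^ 2)%:R].
pose B3 := [set x : X | S3 < (triple_confs V L P inc m k Tri x)%:R].
pose B4 := [set x : X | n%:R / 8 < (collisions V P m x)%:R :> K].
pose B5 := captured K V L P inc m k kp De Q b.
set N : K := #|{: X}|%:R.
have N0 : 0 < N by rewrite /N card_samples exprn_gt0.
have h1 : #|B1|%:R <= N / 4.
  apply: (@le_trans _ _ (\sum_(j < k) #|[set x : X | (D j < f1 j x)%R]|)%:R).
    by rewrite ler_nat card_bigcup_le.
  rewrite natr_sum; apply: le_trans (_ : \sum_(j < k) N / (4 * k%:R) <= _).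
    apply: ler_sum => j _; rewrite ler_pdivlMr ?mulr_gt0 // mulrC.
    have e : 4 * k%:R * (D j / (4 * k%:R)) = D j by rewrite mulrC divfK // mulf_neq0 ?gt_eqF.
    have := @markov_count K X (f1 j) (D j / (4 * k%:R)) (4 * k%:R); rewrite e; apply.
    - by move=> x; apply: sumr_ge0 => a _; apply: sumr_ge0.
    - by rewrite divr_gt0 ?mulr_gt0.
    - by rewrite mulr_gt0.
    - apply: le_trans (tame_moment K V L P inc m q H r V0 rE card_inc n_small linear degree m0 j) _.
      by rewrite ler_wpM2l // ler_pdivlMr ?mulr_gt0 // mulrC D_big.
  rewrite sumr_const card_ord -[leLHS]mulr_natr.
  by rewrite le_eqVlt; apply/orP; left; apply/eqP; field; rewrite gt_eqF.
have h8 (f : X -> K) S e : (forall x, 0 <= f x) -> \sum_x f x <= N * e -> 8 * e <= S -> 0 < S ->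
    #|[set x : X | S < f x]|%:R <= N / 8.
  move=> f0 hs he S0; have := @markov_count K X f (S / 8) 8.
  rewrite (_ : 8 * (S / 8) = S) => [h|]; last by field.
  rewrite ler_pdivlMr // mulrC; apply: h => //; first by rewrite divr_gt0.
  by apply: le_trans hs _; rewrite (ler_wpM2l (ltW N0)) // ler_pdivlMr // mulrC.
have h2 : #|B2|%:R <= N / 8.
  apply: h8 S2_big S20 => //.
  exact: (lconf_moment K V L P inc m k q r V0 rE card_inc n_small).
have h3 : #|B3|%:R <= N / 8.
  apply: h8 S3_big S30 => //.
  exact: (triple_moment K V L P inc m k q r Tri V0 rE card_inc).
have h4 : #|B4|%:R <= N / 8.
  apply: (h8 _ _ _ _ (collision_moment K V P m V0)) => //; last by rewrite divr_gt0 ?ltr0n.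
  rewrite mulrA ler_pdivrMr // mulrAC ler_pdivlMr //.
  have : (64 * n)%:R <= #|V|%:R :> K by rewrite ler_nat.
  rewrite natrM expr2 => h; have : 0 <= n%:R :> K by []. nra.
have h5 : 8 * #|B5|%:R <= N.
  have := card_captured K V L P inc m k kp De Q b V0.
  have De0 : (0 < De)%N.
    rewrite lt0n; apply/eqP => e; move: De_big; rewrite e.
    case: b b_small => [|b'] _; last by rewrite exp0n // leqn0 muln_eq0 expn_eq0.
    have p0 : (0 < 2 ^ (n + #|P|.+1 * Q + n))%N by rewrite expn_gt0.
    by rewrite expn0; case: (2 ^ _)%N p0 => // c _; rewrite mulnS.
  move=> /(_ De0); rewrite -(card_ffun {: I} V) => h.
  rewrite /N -natrM ler_nat.
  have Deb : (0 < 2 ^ (n + #|P|.+1 * Q + n))%N by rewrite expn_gt0.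
  rewrite -(leq_pmul2r Deb); apply: leq_trans h; rewrite mulnAC leq_mul2r.
  by rewrite De_big orbT.
have : (#|B1 :|: B2 :|: B3 :|: B4 :|: B5| < #|{: X}|)%N.
  rewrite -(ltr_nat K) -/N.
  apply: le_lt_trans (_ : #|B1|%:R + #|B2|%:R + #|B3|%:R + #|B4|%:R + #|B5|%:R < N); last by lra.
  rewrite -!natrD ler_nat.
  do 4!(apply: leq_trans (leq_card_setU _ _) _; rewrite leq_add2r).
  by [].
rewrite -cardsT.
move=> lt; have /subsetPn[x _] : ~~ ([set: X] \subset B1 :|: B2 :|: B3 :|: B4 :|: B5).
  by apply: contraL lt => /subset_leq_card; rewrite -leqNgt.
rewrite !in_setU !negb_or => /andP[/andP[/andP[/andP[x1 x2] x3] x4] x5].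
exists x; split => //.
- move=> j jk; rewrite leNgt; apply: contra x1 => h; apply/bigcupP; exists (Ordinal jk) => //.
  by rewrite inE.
- by rewrite leNgt; apply: contra x2 => h; rewrite inE.
- by rewrite leNgt; apply: contra x3 => h; rewrite inE.
- rewrite -(ler_nat K) leNgt; apply: contra x4; rewrite inE natrM; lra.
Qed.

Theorem exists_hard_sample : exists x : X, (8 * collisions V P m x <= n)%N /\
  forall (tau : nat) (hit : 'I_tau -> L -> bool) (z : 'I_tau -> option V),
    (forall t l l' y, l != l' -> hit t l -> hit t l' -> y \in inc l -> y \in inc l' ->
       z t = Some y) ->
    (forall t l1 l2 l3, hit t l1 -> hit t l2 -> hit t l3 ->
       l1 != l2 -> l1 != l3 -> l2 != l3 -> (l1, l2, l3) \in Tri) ->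
    (4 * tau <= n)%N ->
  exists l, (exists2 A : {set I}, #|A| = k & conf V L P inc m x A l) /\ forall t, ~~ hit t l.
Proof.
have [x [tx nc x2 x3 x4]] := exists_good_sample; exists x; split => //.
move=> tau hit z hit2 hit3 htau.
apply: (exists_missed_line V L P inc m k Tri x tau hit z hit2 hit3 K Xc Xc0).
have few : (2 * (tau + collisions V P m x) <= n)%N by move: x4 htau; clear; lia.
have taun : (tau <= n)%N by move: htau; clear; lia.
have hU := card_unhit V P m x tau z few.
have := dense_index_sets_have_configurations K V L P inc m k kp De Q b V0 th D gam gam0 kp0 th0 D0
  kp_small gam_small th_drop supersat Qbig few_touched b_small x _ tx nc hU.
apply: lt_le_trans; apply: le_lt_trans th_big; apply: lerD x3; apply: lerD.
  by rewrite ler_pM2l ?mulr_gt0 // ler_nat.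
by rewrite ler_pM2r ?invr_gt0.
Qed.

End Existence.

(** * Incidences between lines and points of the strip *)

Section Strip.
Variables (q M N H : nat).
Hypothesis fits : M = N + q * H.
Notation V := ('I_q * 'I_M)%type.
Notation L := ('I_N * 'I_H)%type.

Definition strip_inc (l : L) : {set V} := [set y : V | y.2 == l.1 + y.1 * l.2 :> nat].

Lemma strip_bound (l : L) (s : 'I_q) : l.1 + s * l.2 < M.
Proof.
rewrite fits; case: l s => [[a ha] [b hb]] [s hs] /=.
have h : s * b <= q * H by rewrite leq_mul // ltnW.
lia.
Qed.

Lemma card_strip_inc l : #|strip_inc l| = q.
Proof.
rewrite -[RHS]card_ord -cardsT -(@card_imset _ _ (fun s => (s, Ordinal (strip_bound l s)))); last first.
  by move=> s s' [].
apply: eq_card => -[s v]; rewrite inE /=; apply/eqP/imsetP => [e|[s' _ [-> ->]] //].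
by exists s => //; congr pair; apply: val_inj.
Qed.

Lemma strip_degree (y : V) : #|[set l | y \in strip_inc l]| <= H.
Proof.
rewrite -[leqRHS]card_ord -(@card_in_imset _ _ snd) ?max_card // => -[a b] [a' b'].
rewrite !inE /= => /eqP e /eqP e' eb; subst b'; congr pair; apply: val_inj.
by apply: (@addIn (y.1 * b)); rewrite -e -e'.
Qed.

Lemma strip_linear (l l' : L) : l != l' -> #|strip_inc l :&: strip_inc l'| <= 1.
Proof.
move=> ne; apply/card_le1_eqP => -[s v] [s' v']; rewrite !inE /=.
move=> /andP[/eqP e1 /eqP e2] /andP[/eqP e3 /eqP e4].
case: l l' ne e1 e2 e3 e4 => [[a ha] [b hb]] [[a' ha'] [b' hb']] /= ne e1 e2 e3 e4.
have es : s = s' :> nat.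
  have [eb|nb] := eqVneq b b'; last by move: e1 e2 e3 e4; rewrite /=; nia.
  by case/eqP: ne; congr pair; apply: val_inj => /=; move: e1 e2; rewrite eb; lia.
congr pair; first exact: val_inj.
by apply: val_inj; rewrite /= e1 e3 es.
Qed.

Lemma card_ord_range c d : #|[set v : 'I_M | c <= v < d]| <= d - c.
Proof.
rewrite cardE -(size_map val) -[leqRHS](size_iota c); apply: uniq_leq_size.
  by rewrite map_inj_uniq ?enum_uniq //; exact: val_inj.
move=> i /mapP[v]; rewrite mem_enum inE mem_iota => /andP[h1 h2] -> /=; rewrite h1 /=; lia.
Qed.

(** For such a height every slope b < H gives an intercept between 0 and N. *)
Lemma strip_degree_ge (y : V) : q * H <= y.2 < N -> H <= #|[set l | y \in strip_inc l]|.
Proof.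
case: y => s v /= /andP[h1 h2].
have sb (b : 'I_H) : s * b <= v.
  by apply: leq_trans h1; rewrite leq_mul // ltnW.
have lt (b : 'I_H) : v - s * b < N by apply: leq_ltn_trans h2; exact: leq_subr.
rewrite -[leqLHS]card_ord -cardsT -(@card_imset _ _ (fun b => (Ordinal (lt b), b))); last first.
  by move=> b b' [].
apply/subset_leq_card/subsetP => l /imsetP[b _ ->]; rewrite !inE /=.
by rewrite subnK.
Qed.

(** Double counting of incidences. The heights of degree below H cost at most half of the guaranteed
    size of C, poor lines account for at most half of the incidences left, and a rich line carries
    at most q of the rest. *)
Lemma strip_supersaturated (k De : nat) (C : {set V}) :
    0 < De -> 0 < q -> 4 * De * (q * H) <= M -> 4 * De * k <= q -> #|{: V}| <= De * #|C| ->
  #|{: L}| <= 4 * De * #|rich _ _ strip_inc k C|.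
Proof.
move=> De0 q0 hH hk; rewrite !card_prod !card_ord => hC.
pose C' := [set y in C | q * H <= y.2 < N].
pose S := \sum_l #|strip_inc l :&: C|.
have low : H * #|C'| <= S.
  rewrite /S (eq_bigr (fun l => \sum_(y in C) (y \in strip_inc l))) => [|l _]; last first.
    rewrite -sum1_card [LHS]big_mkcond [RHS]big_mkcond; apply: eq_bigr => y _.
    by rewrite in_setI; case: (y \in C); case: (y \in strip_inc l).
  rewrite exchange_big /= mulnC -sum_nat_const big_mkcond [leqRHS]big_mkcond.
  apply: leq_sum => y _; rewrite in_set; case: (y \in C) => //=; case: ifP => // h.
  by rewrite sum_bool_card strip_degree_ge.
have upp : S <= q * #|rich _ _ strip_inc k C| + k * (N * H).
  have -> : N * H = #|{: L}| by rewrite card_prod !card_ord.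
  rewrite /S (bigID (fun l => l \in rich _ _ strip_inc k C)) /=; apply: leq_add.
    rewrite mulnC -sum_nat_const; apply: leq_sum => l _.
    by rewrite -[leqRHS](card_strip_inc l) subset_leq_card // subsetIl.
  rewrite mulnC -sum_nat_const big_mkcond; apply: leq_sum => l _; case: ifP => //.
  by rewrite inE -ltnNge => /ltnW.
have cC : #|C| <= #|C'| + q * (2 * (q * H)).
  rewrite -(cardsID C' C); apply: leq_add; first by rewrite subset_leq_card // subsetIr.
  pose B := [set v : 'I_M | 0 <= v < q * H] :|: [set v : 'I_M | N <= v < M].
  apply: leq_trans (_ : #|setX [set: 'I_q] B| <= _).
    apply/subset_leq_card/subsetP => -[s v]; rewrite !inE /= => /andP[nC yC].
    by move: nC; rewrite yC /= ltn_ord; lia.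
  rewrite cardsX cardsT card_ord leq_mul2l; apply/orP; right.
  apply: leq_trans (leq_card_setU _ _) _.
  by have := card_ord_range 0 (q * H); have := card_ord_range N M; lia.
set R := #|rich _ _ _ _ _| in upp *.
have e1 : q * (4 * De * R) + 4 * De * (k * (N * H)) >= 4 * De * (H * #|C'|) by nia.
have e2 : 4 * (De * #|C|) <= 4 * De * #|C'| + 2 * (q * M) by nia.
have NM : N * H <= M * H by rewrite leq_mul2r fits leq_addr orbT.
have e3 : 4 * De * (k * (N * H)) <= q * (M * H) by rewrite mulnA leq_mul.
have e4 : 2 * (q * M) <= 4 * De * #|C'| by lia.
have e5 : H * (2 * (q * M)) <= H * (4 * De * #|C'|) by rewrite leq_mul2l e4 orbT.
have e6 : q * (M * H) <= q * (4 * De * R) by move: e1 e3 e5; clear; lia.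
rewrite leq_pmul2l // in e6; apply: leq_trans e6; rewrite leq_mul2r; apply/orP; right; lia.
Qed.

End Strip.

(** * Counting concurrent triples by a gcd sum *)

Section ConcurrentTriples.
Local Open Scope ring_scope.
Variable K : realFieldType.

Definition harmonic n : K := \sum_(i < n) i.+1%:R^-1.

Lemma harmonic_pow2 h : harmonic (2 ^ h) <= h.+1%:R.
Proof.
elim: h => [|h IH]; first by rewrite /harmonic expn0 big_ord1 invr1.
rewrite /harmonic expnS mul2n -addnn big_split_ord /= -[h.+2%:R]natr1; apply: lerD => //.
apply: le_trans (_ : \sum_(i < 2 ^ h) (2 ^ h)%:R^-1 <= _).
  apply: ler_sum => i _; rewrite lef_pV2 ?posrE ?ltr0n ?expn_gt0 // ler_nat; lia.
by rewrite sumr_const card_ord -[leLHS]mulr_natr mulVf // pnatr_eq0 -lt0n expn_gt0.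
Qed.

(** For d = g t the summand is 1/t, and each t occurs at most once; the successors shift the ranges
    to start at 1. *)
Lemma sum_multiples H g : \sum_(d < H) ((g.+1 %| d.+1)%N)%:R * (g.+1%:R / d.+1%:R) <= harmonic H.
Proof.
apply: le_trans (_ : \sum_(d < H) \sum_(t < H) ((d.+1 == g.+1 * t.+1)%N)%:R * t.+1%:R^-1 <= _).
  apply: ler_sum => d _; case: (boolP (_ %| _)%N) => [/dvdnP[[|t] e]|_]; first by [].
    have tH : (t < H)%N by have := ltn_ord d; nia.
    rewrite (bigD1 (Ordinal tH)) //= e [(t.+1 * _)%N]mulnC eqxx !mul1r.
    rewrite -[leLHS]addr0; apply: lerD; last by apply: sumr_ge0 => i _; rewrite ?mulr_ge0 ?invr_ge0.
    by rewrite natrM invfM mulrA mulfV ?mul1r // pnatr_eq0.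
  by rewrite mul0r sumr_ge0 // => t _; rewrite ?mulr_ge0 ?invr_ge0.
rewrite exchange_big; apply: ler_sum => t _; rewrite -mulr_suml -[leRHS]mul1r ler_wpM2r ?invr_ge0 //.
rewrite -natr_sum -[1]/(1%:R) ler_nat sum_bool_card; apply/card_le1_eqP => d d'.
by rewrite !inE => /eqP e /eqP e'; apply: val_inj => /=; lia.
Qed.

(** The gcd is at most the sum of all common divisors g. For fixed g there are at most H/g multiples
    e, and [sum_multiples] handles d. *)
Lemma sum_gcd H :
  \sum_(d < H) \sum_(e < H) (gcdn d.+1 e.+1)%:R / d.+1%:R <= H%:R * harmonic H ^+ 2.
Proof.
apply: le_trans (_ : \sum_(d < H) \sum_(e < H) \sum_(g < H)
   ((g.+1 %| d.+1)%N)%:R * (g.+1%:R / d.+1%:R) * ((g.+1 %| e.+1)%N)%:R <= _).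
  apply: ler_sum => d _; apply: ler_sum => e _.
  have g0 : (0 < gcdn d.+1 e.+1)%N by rewrite gcdn_gt0.
  have gH : ((gcdn d.+1 e.+1).-1 < H)%N.
    by have := dvdn_leq (ltn0Sn d) (dvdn_gcdl d.+1 e.+1); have := ltn_ord d; lia.
  rewrite (bigD1 (Ordinal gH)) //= prednK // dvdn_gcdl dvdn_gcdr mul1r mulr1 lerDl.
  by apply: sumr_ge0 => g _; rewrite !mulr_ge0 ?invr_ge0.
apply: le_trans (_ : \sum_(g < H) harmonic H * (H%:R / g.+1%:R) <= _).
  rewrite (eq_bigr (fun d : 'I_H => \sum_(g < H) ((g.+1 %| d.+1)%N)%:R * (g.+1%:R / d.+1%:R) *
     \sum_(e < H) ((g.+1 %| e.+1)%N)%:R)) => [|d _]; last first.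
    by rewrite exchange_big; apply: eq_bigr => g _; rewrite mulr_sumr.
  rewrite exchange_big; apply: ler_sum => g _ /=; rewrite -mulr_suml.
  apply: ler_pM; rewrite ?sum_multiples ?sumr_ge0 //.
    by move=> d _; rewrite !mulr_ge0 ?invr_ge0.
  rewrite -natr_sum ler_pdivlMr ?ltr0n // -natrM ler_nat.
  have -> : (\sum_(e < H) (g.+1 %| e.+1) = H %/ g.+1)%N.
    by rewrite divn_count_dvd big_add1 /= big_mkord.
  exact: leq_trunc_div.
by rewrite -!mulr_sumr -/(harmonic H) le_eqVlt; apply/orP; left; apply/eqP; ring.
Qed.

(** A nonzero distance from b1 is attained at most twice. *)
Lemma sum_distances H (b1 : 'I_H) (F : nat -> K) : (forall d, 0 <= F d) ->
  \sum_(b : 'I_H | b != b1) F `|b - b1|%N <= 2 * \sum_(d < H) F d.+1.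
Proof.
move=> F0.
apply: le_trans (_ : \sum_(b : 'I_H) \sum_(d < H) (d.+1 == `|b - b1|%N)%:R * F d.+1 <= _).
  rewrite big_mkcond; apply: ler_sum => b _; case: ifP => [ne|_]; last first.
    by apply: sumr_ge0 => d _; rewrite ?mulr_ge0 ?invr_ge0.
  have ne' : b != b1 :> nat by [].
  have dH : (`|b - b1|%N.-1 < H)%N by have := ltn_ord b; have := ltn_ord b1; lia.
  have e : (`|b - b1|%N.-1).+1 = `|b - b1|%N by lia.
  rewrite (bigD1 (Ordinal dH)) //= e eqxx mul1r lerDl; apply: sumr_ge0 => d _.
  by rewrite ?mulr_ge0 ?invr_ge0.
rewrite exchange_big mulr_sumr; apply: ler_sum => d _; rewrite -mulr_suml ler_wpM2r //.
rewrite -natr_sum -[2]/(2%:R) ler_nat sum_bool_card cardE -(size_map val).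
apply: (@leq_trans (size [:: b1 + d.+1; b1 - d.+1]))%N => //; apply: uniq_leq_size.
  by rewrite map_inj_uniq ?enum_uniq //; exact: val_inj.
move=> i /mapP[b]; rewrite mem_enum !inE => /eqP h ->; rewrite /= in h *; lia.
Qed.

Variables (N H : nat).
Hypothesis HN : (H <= N)%N.
Notation L := ('I_N * 'I_H)%type.

(** The equation eliminates X from a_i - a_1 = - (b_i - b_1) X for i = 2, 3. *)
Definition concurrent : {set L * L * L} := [set p : L * L * L |
  [&& p.1.2.2 != p.1.1.2, p.2.2 != p.1.1.2 &
   (p.1.2.1%:Z - p.1.1.1%:Z) * (p.2.2%:Z - p.1.1.2%:Z) ==
   (p.2.1%:Z - p.1.1.1%:Z) * (p.1.2.2%:Z - p.1.1.2%:Z)]].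

(** With d, e the slope differences and g their gcd, the equation forces a2 = a1 modulo d/g, and a2
    determines a3. As d/g <= H <= N, the N / (d/g) + 1 classes are at most 2 N g / d. *)
Lemma card_concurrent_slopes (a1 : 'I_N) (b1 b2 b3 : 'I_H) : b2 != b1 -> b3 != b1 ->
  #|[set a : 'I_N * 'I_N | (a.1%:Z - a1%:Z) * (b3%:Z - b1%:Z) == (a.2%:Z - a1%:Z) * (b2%:Z - b1%:Z)]|%:R
   <= 2 * N%:R * ((gcdn `|b2 - b1|%N `|b3 - b1|%N)%:R / `|b2 - b1|%N%:R) :> K.
Proof.
move=> n2 n3; set A := [set a | _].
set d := `|b2 - b1|%N; set e := `|b3 - b1|%N; set g := gcdn d e.
have n2' : b2 != b1 :> nat by []. have n3' : b3 != b1 :> nat by [].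
have d0 : (0 < d)%N by rewrite /d; lia.
have e0 : (0 < e)%N by rewrite /e; lia.
have g0 : (0 < g)%N by rewrite gcdn_gt0 d0.
have dE : d = (d %/ g * g)%N by rewrite divnK // dvdn_gcdl.
have eE : e = (e %/ g * g)%N by rewrite divnK // dvdn_gcdr.
have cop : coprime (d %/ g) (e %/ g).
  by rewrite /coprime -(eqn_pmul2r g0) mul1n muln_gcdl -dE -eE.
set d' := (d %/ g)%N in dE cop; have d'0 : (0 < d')%N by rewrite divn_gt0 // dvdn_leq // dvdn_gcdl.
have cong (a : 'I_N * 'I_N) : a \in A -> a.1 = a1 %[mod d'].
  rewrite inE => /eqP h.
  have h' : (`|a.1 - a1| * e = `|a.2 - a1| * d)%N by have := congr1 absz h; rewrite !abszM.
  have : (d' %| `|a.1 - a1| * (e %/ g))%N.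
    apply/dvdnP; exists `|a.2 - a1|%N; apply/eqP; rewrite -(eqn_pmul2r g0) -!mulnA -eE -dE.
    exact/eqP.
  rewrite Gauss_dvdl // => dv; apply/eqP.
  case: (leqP a1 a.1) => le; first by rewrite eqn_mod_dvd // (_ : (a.1 - a1 = `|a.1 - a1|)%N) //; lia.
  by rewrite eq_sym eqn_mod_dvd ?(ltnW le) // (_ : (a1 - a.1 = `|a.1 - a1|)%N) //; lia.
have cA : (#|A| <= N %/ d' + 1)%N.
  rewrite addn1 -[leqRHS]card_ord.
  rewrite -(@card_in_imset _ _ (fun a : 'I_N * 'I_N => inord (a.1 %/ d') : 'I_(N %/ d').+1) A) ?max_card //.
  move=> a a' aA a'A /(congr1 val); rewrite /= !inordK ?ltnS ?leq_div2r // ?(ltnW (ltn_ord _)) // => h.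
  have e1 : a.1 = a'.1.
    apply: val_inj => /=; rewrite (divn_eq a.1 d') (divn_eq a'.1 d') h.
    by rewrite (cong a aA) (cong a' a'A).
  move: aA a'A; rewrite !inE e1 => /eqP h1 /eqP h2.
  have nz : b2%:Z - b1%:Z != 0 by rewrite subr_eq0 eqz_nat.
  have := mulIf nz (etrans (esym h1) h2) => /addIr[] e2.
  by case: a a' e1 e2 {h h1 h2} => [u v] [u' v'] /= -> e2; congr pair; apply: val_inj.
have d'K : (d'%:R : K) != 0 by rewrite pnatr_eq0 -lt0n.
have gK : (g%:R : K) != 0 by rewrite pnatr_eq0 -lt0n.
have -> : g%:R / d%:R = d'%:R^-1 :> K.
  by rewrite dE natrM invfM mulrCA mulfV // mulr1.
rewrite ler_pdivlMr ?ltr0n // -!natrM ler_nat.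
have : (d' <= N)%N.
  apply: leq_trans HN; apply: leq_trans (leq_div _ _) _.
  by rewrite /d; have := ltn_ord b1; have := ltn_ord b2; lia.
have := leq_trunc_div N d'; nia.
Qed.

Lemma card_concurrent :
  #|concurrent|%:R <= 8 * (N * H)%:R ^+ 2 * harmonic H ^+ 2 :> K.
Proof.
pose A a1 b1 b2 b3 := [set a : 'I_N * 'I_N |
  (a.1%:Z - a1%:Z) * (b3%:Z - b1%:Z) == (a.2%:Z - a1%:Z) * (b2%:Z - b1%:Z)].
have -> : #|concurrent| = (\sum_(a1 : 'I_N) \sum_(b1 : 'I_H) \sum_(b2 : 'I_H | b2 != b1)
    \sum_(b3 : 'I_H | b3 != b1) #|A a1 b1 b2 b3|)%N.
  have bp (T T' : finType) (F : T * T' -> nat) : (\sum_p F p = \sum_t \sum_t' F (t, t'))%N.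
    by rewrite pair_bigA; apply: eq_bigr => -[].
  rewrite -sum_bool_card !bp; apply: eq_bigr => a1 _; apply: eq_bigr => b1 _.
  rewrite bp exchange_big [RHS]big_mkcond; apply: eq_bigr => b2 _ /=.
  case: ifP => n2; last by rewrite big1 // => a2 _; rewrite big1.
  under eq_bigr => a2 _ do rewrite bp exchange_big.
  rewrite exchange_big [RHS]big_mkcond; apply: eq_bigr => b3 _ /=.
  case: ifP => n3; last by rewrite big1 // => a2 _; rewrite big1.
  by rewrite -sum_bool_card bp.
rewrite natr_sum.
apply: le_trans (_ : \sum_(a1 : 'I_N) H%:R * (8 * N%:R * (H%:R * harmonic H ^+ 2)) <= _); last first.
  rewrite sumr_const card_ord -[leLHS]mulr_natl natrM.
  by rewrite le_eqVlt; apply/orP; left; apply/eqP; ring.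
apply: ler_sum => a1 _; rewrite natr_sum.
have -> : H%:R * (8 * N%:R * (H%:R * harmonic H ^+ 2)) =
  \sum_(b1 : 'I_H) (8 * N%:R * (H%:R * harmonic H ^+ 2)).
  by rewrite sumr_const card_ord -[RHS]mulr_natl.
apply: ler_sum => b1 _; rewrite natr_sum.
apply: le_trans (_ : \sum_(b2 : 'I_H | b2 != b1) \sum_(b3 : 'I_H | b3 != b1)
   2 * N%:R * ((gcdn `|b2 - b1|%N `|b3 - b1|%N)%:R / `|b2 - b1|%N%:R) <= _).
  apply: ler_sum => b2 n2; rewrite natr_sum; apply: ler_sum => b3 n3.
  exact: card_concurrent_slopes.
apply: le_trans (_ : \sum_(b2 : 'I_H | b2 != b1) 
   2 * \sum_(e < H) 2 * N%:R * ((gcdn `|b2 - b1|%N e.+1)%:R / `|b2 - b1|%N%:R) <= _).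
  apply: ler_sum => b2 n2.
  apply: (sum_distances _ b1 (fun e => 2 * N%:R * ((gcdn `|b2 - b1|%N e)%:R / `|b2 - b1|%N%:R))).
  by move=> e; rewrite !mulr_ge0 ?invr_ge0.
apply: le_trans (sum_distances _ b1 (fun d => 2 * \sum_(e < H) 2 * N%:R * ((gcdn d e.+1)%:R / d%:R)) _) _.
  by move=> d; rewrite mulr_ge0 // sumr_ge0 // => e _; rewrite !mulr_ge0 ?invr_ge0.
have -> : 2 * \sum_(d < H) 2 * \sum_(e < H) 2 * N%:R * ((gcdn d.+1 e.+1)%:R / d.+1%:R) =
   8 * N%:R * \sum_(d < H) \sum_(e < H) (gcdn d.+1 e.+1)%:R / d.+1%:R :> K.
  rewrite !mulr_sumr; apply: eq_bigr => d _; rewrite !mulr_sumr; apply: eq_bigr => e _; ring.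
by rewrite ler_wpM2l ?mulr_ge0 // sum_gcd.
Qed.

End ConcurrentTriples.

(** * Powers of two and the inequalities between their exponents *)

Section Exponents.
Local Open Scope ring_scope.
Notation P2 z := ((2%:R : rat) ^ (z : int)).

Lemma P2_gt0 z : 0 < P2 z. Proof. by rewrite exprz_gt0. Qed.
Lemma P2_ge0 z : 0 <= P2 z. Proof. by rewrite exprz_ge0. Qed.
Lemma P2D y z : P2 y * P2 z = P2 (y + z). Proof. by rewrite expfzDr. Qed.
Lemma P2X z j : P2 z ^+ j = P2 (z * j%:Z). Proof. by rewrite exprnP exprz_exp. Qed.
Lemma P2n a : (2 ^ a)%:R = P2 a%:Z. Proof. by rewrite natrX. Qed.
Lemma P2V z : (P2 z)^-1 = P2 (- z). Proof. by rewrite invr_expz. Qed.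
Lemma P2_le y z : (P2 y <= P2 z) = (y <= z). Proof. by rewrite ler_eXz2l // ltr1n. Qed.
Lemma P2_lt y z : (P2 y < P2 z) = (y < z). Proof. by rewrite ltr_eXz2l // ltr1n. Qed.

Lemma P2_2 : 2 = P2 1. Proof. by []. Qed.
Lemma P2_4 : 4 = P2 2. Proof. by []. Qed.
Lemma P2_8 : 8 = P2 3. Proof. by []. Qed.
Lemma P2_16 : 16 = P2 4. Proof. by []. Qed.

(* All quantities are powers of two.  With [rho = 2 ^ - e] the ratio of the sample size to [M], the
   choice of [h] makes [H * rho ^ (k - 1)] large, so that rich lines outnumber sample points, and
   [H * rho ^ k] small, so that concurrent triples of rich lines are rare. *)
Variables (kap k h nu e re mu s B Qe hh de : nat) (b : nat -> nat).
Hypothesis deE : de = 16%N.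
Hypothesis kE : k = (2 ^ kap)%N.
Hypothesis nuE : nu = (h + kap + 36)%N.
Hypothesis hE : (h + e = k * e + s)%N.
Hypothesis muE : (re + mu + e = nu)%N.
Hypothesis reE : re = (3 + kap + Qe)%N.
Hypothesis QeE : Qe = (44 + 3 * kap + 2 * B)%N.
Hypothesis b0 : (19 <= b 0)%N.
(** Exactly what [th_drop] demands: the loss 2^(-b j) enters once through [kp j] and twice through
    the square of [th j]. *)
Hypothesis bS : forall j, (j < k)%N -> (3 * b j + 66 + 5 * kap <= b j.+1)%N.
Hypothesis bB : forall j, (j <= k)%N -> (b j <= B)%N.
Hypothesis s_big : (k * (re + 1) + 1 <= s)%N.
Hypothesis s_big' : (2 * B + k + 9 <= s)%N.
Hypothesis e_big : (2 * s + kap + 44 + 2 * hh + B <= 2 * e)%N.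
Hypothesis hh_big : (h < 2 ^ hh)%N.
Hypothesis mu_big : (Qe + 2 <= mu)%N.

(** With De = 2^16 this is q = 4 De k, and M = 4 De q H: the two size conditions of
    [strip_supersaturated] hold with equality. *)
Let q := (2 ^ (kap + 18))%N.
Let M := (2 ^ nu)%N.
Let H := (2 ^ h)%N.
Let N := (M - q * H)%N.
Let R := (2 ^ re)%N.
Let m := (2 ^ mu)%N.
Let th j := P2 (nu%:Z + h%:Z - (b j)%:Z - (e * j)%N%:Z).
(** The largest value allowed by [kp_small]. *)
Let kp j := P2 (h%:Z - (b j)%:Z - (e * j)%N%:Z - 20 - (re * j)%N%:Z - kap%:Z).
(** The bound of [D_big] with the square of the mean doubled to absorb the other term. *)
Let D j := P2 (21 + 2 * kap%:Z + nu%:Z + 2 * h%:Z - (re * j)%N%:Z - 2 * (e * j)%N%:Z).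
Let gam := P2 (- (43 + 3 * kap + 2 * B)%N%:Z).
Notation V := ('I_q * 'I_M)%type.
Notation L := ('I_N * 'I_H)%type.
Notation I := ('I_R * 'I_m)%type.

Lemma param_qH : (2 * (q * H) <= M)%N.
Proof. by rewrite /q /H /M -expnD -expnS leq_exp2l //; lia. Qed.

Lemma param_fits : M = (N + q * H)%N.
Proof. by rewrite /N subnK //; have := param_qH; lia. Qed.

Lemma param_cardV : #|{: V}| = (2 ^ (kap + 18 + nu))%N.
Proof. by rewrite card_prod !card_ord -expnD. Qed.

Lemma param_cardI : #|{: I}| = (2 ^ (re + mu))%N.
Proof. by rewrite card_prod !card_ord -expnD. Qed.

Lemma param_cardL_le : #|{: L}|%:R <= P2 (nu%:Z + h%:Z).
Proof.
rewrite card_prod !card_ord -P2D -!P2n -natrM ler_nat leq_mul2r; apply/orP; right; exact: leq_subr.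
Qed.

Lemma param_supersat (C : {set V}) : (#|{: V}| <= 2 ^ de * #|C|)%N ->
  th 0 <= #|rich _ _ (strip_inc q M N H) k C|%:R.
Proof.
move=> hC; have q0 : (0 < q)%N by rewrite expn_gt0.
have e4 : (4 * 2 ^ de = 2 ^ (de + 2))%N by rewrite expnD mulnC.
have := strip_supersaturated q M N H param_fits k (2 ^ de) C (expn_gt0 _ _) q0 _ _ hC.
rewrite e4 => h1.
have {h1} : (#|{: L}| <= 2 ^ (de + 2) * #|rich _ _ (strip_inc q M N H) k C|)%N.
  by apply: h1; rewrite /q /H /M ?kE -?expnD leq_exp2l //; lia.
set rr := #|rich _ _ _ _ _| => hr.
have MN : (M <= 2 * N)%N by have := param_qH; have := param_fits; lia.
have : (M * H <= 2 ^ (de + 3) * rr)%N.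
  rewrite card_prod !card_ord in hr; rewrite addnS expnS -mulnA.
  apply: leq_trans (_ : 2 * (N * H) <= _)%N; last by rewrite leq_mul2l hr.
  by rewrite mulnA leq_mul2r MN orbT.
rewrite -(ler_nat rat) !natrM /M /H !P2n P2D => h1.
rewrite -(ler_pM2l (P2_gt0 (de + 3)%N%:Z)). apply: le_trans h1; rewrite P2D P2_le; lia.
Qed.

Lemma param_cardI_r : #|{: I}|%:R * P2 (- nu%:Z) = P2 (- e%:Z).
Proof. by rewrite param_cardI P2n P2D; congr (_ ^ _); lia. Qed.

Lemma param_D j : (j < k)%N ->
  4 * k%:R * ((#|'I_R| ^ j)%:R * (#|{: V}|%:R *
     ((H%:R * (m%:R * P2 (- nu%:Z)) ^+ j) ^+ 2 +
       H%:R * ((m%:R * P2 (- nu%:Z)) ^+ j * 2 ^+ j.+1)))) <= D j.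
Proof.
move=> jk; rewrite param_cardV card_ord -expnM kE /H /m P2_4 [in 2 ^+ _]P2_2 !P2n !P2D !P2X !P2D.
have e1 : (mu%:Z - nu%:Z) * j%:Z = - ((e * j)%N%:Z + (re * j)%N%:Z).
  by rewrite -muE; lia.
rewrite e1.
(* This says H (m r)^j >= 2^(j+1), so the square dominates the term from a single line. *)
have k2 : (j * (e + re) + j + 1 <= h)%N.
  have : (j * (e + re + 1) <= (k - 1) * (e + re + 1))%N by rewrite leq_mul2r; apply/orP; right; lia.
  move: hE s_big jk; clear; case: k => // k' hE s_big _; rewrite subn1 /=; lia.
set x : rat := (X in _ * (X + _)); set y : rat := (X in _ * (_ + X)).
have yx : y <= x by rewrite /x /y P2X P2_le; lia.
have : x + y <= P2 1 * x by rewrite -P2_2; lra.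
rewrite {2}/x P2X !P2D => xy.
apply: le_trans (ler_wpM2l (P2_ge0 _) (ler_wpM2l (P2_ge0 _) (ler_wpM2l (P2_ge0 _) xy))) _.
rewrite /D !P2D P2_le; lia.
Qed.

Lemma param_S3 : 8 * (#|concurrent N H|%:R * ((#|{: I}|%:R * P2 (- nu%:Z)) ^+ k) ^+ 3) <=
  P2 (6 + 2 * nu%:Z + 2 * h%:Z + 2 * hh%:Z - 3 * (e * k)%N%:Z).
Proof.
have HN : (H <= N)%N.
  have q0 : (0 < q)%N by rewrite expn_gt0.
  apply: leq_trans (leq_pmull H q0) _; rewrite /N -(leq_add2r (q * H)) addnn -mul2n.
  by apply: leq_trans param_qH _; rewrite subnK // [leqRHS]param_fits leq_addl.
have hc := card_concurrent rat N H HN.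
have hh' : harmonic rat H <= P2 hh%:Z.
  by apply: le_trans (harmonic_pow2 _ _) _; rewrite -P2n ler_nat.
have h0 : 0 <= harmonic rat H by apply: sumr_ge0 => i _; rewrite invr_ge0.
have hc' : #|concurrent N H|%:R <= P2 (3 + 2 * (nu%:Z + h%:Z) + 2 * hh%:Z).
  apply: le_trans hc _.
  have -> : P2 (3 + 2 * (nu%:Z + h%:Z) + 2 * hh%:Z) = 8 * P2 (nu%:Z + h%:Z) ^+ 2 * P2 hh%:Z ^+ 2.
    by rewrite P2_8 !P2X !P2D; congr (_ ^ _); lia.
  have hl := param_cardL_le; rewrite card_prod !card_ord in hl.
  apply: ler_pM; rewrite ?mulr_ge0 ?sqr_ge0 //.
    by rewrite ler_pM2l //; rewrite ler_sqr ?nnegrE // P2_ge0.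
  by rewrite ler_sqr ?nnegrE // P2_ge0.
rewrite param_cardI_r P2_8 !P2X.
apply: le_trans (ler_wpM2l (P2_ge0 _) (ler_wpM2r (P2_ge0 _) hc')) _.
rewrite !P2D P2_le; lia.
Qed.

Lemma hard_sample_from_exponents : exists x : {ffun I -> V}, (8 * collisions V 'I_R m x <= #|{: I}|)%N /\
  forall (tau : nat) (hit : 'I_tau -> L -> bool) (z : 'I_tau -> option V),
    (forall t l l' y, l != l' -> hit t l -> hit t l' -> y \in strip_inc q M N H l ->
       y \in strip_inc q M N H l' -> z t = Some y) ->
    (forall t l1 l2 l3, hit t l1 -> hit t l2 -> hit t l3 ->
       l1 != l2 -> l1 != l3 -> l2 != l3 -> (l1, l2, l3) \in concurrent N H) ->
    (4 * tau <= #|{: I}|)%N ->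
  exists l, (exists2 A : {set I}, #|A| = k & conf V L 'I_R (strip_inc q M N H) m x A l) /\
    forall t, ~~ hit t l.
Proof.
have k0 : (0 < k)%N by rewrite kE expn_gt0.
apply: (@exists_hard_sample rat V L 'I_R (strip_inc q M N H) m k q H (P2 (- nu%:Z)) (concurrent N H)
  k0 _ _ (card_strip_inc q M N H param_fits) _ (strip_linear q M N H param_fits) (strip_degree q M N H) _
  kp th D gam (P2 (k + 6 + B)%N%:Z) (P2 (4 + k%:Z + nu%:Z + h%:Z - (e * k)%N%:Z))
  (P2 (6 + 2 * nu%:Z + 2 * h%:Z + 2 * hh%:Z - 3 * (e * k)%N%:Z)) (2 ^ de) (2 ^ Qe)
  (2 ^ (re + mu - 2))).
- by rewrite param_cardV expn_gt0.
- by rewrite param_cardV P2n P2D /q P2n; congr (_ ^ _); lia.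
- by rewrite param_cardI_r mul1r P2_2 P2V P2_le; lia.
- by rewrite expn_gt0.
- exact: P2_gt0.
- by move=> j; exact: P2_gt0.
- by move=> j; exact: P2_gt0.
- by move=> j; exact: P2_gt0.
- by move=> j jk; rewrite card_ord -expnM param_cardV P2_4 /kp /th !P2n !P2D P2_le; lia.
- move=> j jk; have bj := bB j (ltnW jk).
  by rewrite card_ord -expnM param_cardV P2_16 /D /gam /th !P2n P2X !P2D P2_le; lia.
- move=> j jk; have bj := bS j jk.
  rewrite param_cardV param_cardI P2_16 P2_8 {1}kE /D /kp /th !P2n P2X !P2D P2_le; lia.
- exact: param_supersat.
- by rewrite /gam P2n P2D -[1]/(P2 0) P2_lt; lia.
- by rewrite card_ord (_ : (8 = 2 ^ 3)%N) // {1}kE -!expnD leq_exp2l //; lia.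
- by rewrite param_cardI (_ : (4 = 2 ^ 2)%N) // -expnD leq_exp2l //; lia.
- exact: param_D.
(* De^b = 2^(16 n/4) = 2^(4 n). The sets U and B cost 2^(2 n), and the other 2^(2 n) pays for the
   fingerprints and the factor 8. *)
- rewrite param_cardI card_ord -expnM (_ : (8 = 2 ^ 3)%N) // -expnD leq_exp2l //.
  have -> : (de * 2 ^ (re + mu - 2) = 4 * 2 ^ (re + mu))%N.
    rewrite (_ : (re + mu = (re + mu - 2) + 2)%N); last by lia.
    by rewrite addnK expnD deE mulnCA mulnC.
  have h1 : ((2 ^ re).+1 * 2 ^ Qe + 3 <= 2 * 2 ^ (re + mu))%N.
    apply: leq_trans (_ : 2 ^ (re + Qe + 2) <= _)%N; last first.
      by rewrite -expnS leq_exp2l //; lia.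
    rewrite !expnD mulSn; have r4 : (4 <= 2 ^ re)%N by rewrite (_ : (4 = 2 ^ 2)%N) // leq_exp2l //; lia.
    have q1 : (1 <= 2 ^ Qe)%N by rewrite expn_gt0.
    move: r4 q1; clear; move: (2 ^ re)%N (2 ^ Qe)%N => a c; rewrite -[(2 ^ 2)%N]/4%N; nia.
  move: h1; clear; move: (2 ^ (re + mu))%N => w; rewrite /R; lia.
- rewrite param_cardI param_cardV (_ : (64 = 2 ^ 6)%N) // -expnD leq_exp2l //; lia.
- rewrite param_cardI_r P2_8 [in 2 ^+ _]P2_2 !P2X !P2D.
  apply: le_trans (ler_wpM2l (P2_ge0 _) (ler_wpM2r (P2_ge0 _) param_cardL_le)) _.
  by rewrite !P2D P2_le; lia.
- exact: param_S3.
- exact: P2_gt0.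
- exact: P2_gt0.
- exact: P2_gt0.
- by rewrite param_cardI expn_gt0.
- have bk := bB k (leqnn k).
  (* Each of the three terms is at most a quarter of [th k]: the first by [s_big'], the second by
     the choice of [Xc], the third by [e_big]. *)
  have h1 : P2 1 * P2 (k + 6 + B)%N%:Z * P2 (re + mu)%N%:Z <= th k * P2 (- 2).
    by rewrite /th !P2D P2_le; move: bk hE muE s_big'; clear; lia.
  have h2 : P2 (4 + k%:Z + nu%:Z + h%:Z - (e * k)%N%:Z) / P2 (k + 6 + B)%N%:Z <= th k * P2 (- 2).
    by rewrite /th P2V !P2D P2_le; move: bk; clear; lia.
  have h3 : P2 (6 + 2 * nu%:Z + 2 * h%:Z + 2 * hh%:Z - 3 * (e * k)%N%:Z) <= th k * P2 (- 2).
    by rewrite /th !P2D P2_le; move: bk hE e_big nuE; clear; lia.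
  have t0 : 0 < th k by exact: P2_gt0.
  rewrite param_cardI P2n [in 2 * _]P2_2; move: h1 h2 h3.
  rewrite (_ : P2 (- 2) = 1 / 4) //; lra.
Qed.

End Exponents.

(** * Concrete exponents *)

Section Instance.

Lemma quadratic_le_pow4 k : 16 <= k -> 28 * k * k + 400 * k + 200 <= 4 ^ k.
Proof.
elim: k => // k IH; rewrite leq_eqVlt => /orP[/eqP <-|]; last first.
  rewrite ltnS => /IH h; rewrite expnS; move: (4 ^ k) h => F; nia.
apply: (@leq_trans (2 ^ 14)); first by [].
by rewrite (_ : 4 = 2 ^ 2) // -expnM leq_exp2l.
Qed.

(** Used with F = 4^k. The left side is linear in F with coefficients quadratic in k, so it fits
    below F^2, which will be e. *)
Lemma exponent_budget kap k F : kap <= k -> 28 * k * k + 400 * k + 200 <= F ->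
  2 * (k * (47 + 4 * kap + 2 * ((66 + 5 * kap) * F) + 1) + 1) + 3 * kap + 46 + 8 * k
    + (66 + 5 * kap) * F <= F * F.
Proof.
move=> kk hF.
apply: leq_trans (_ : F * (28 * k * k + 400 * k + 200) <= _); last by rewrite leq_mul2l hF orbT.
have F1 : 200 <= F by lia.
have a1 : kap * F <= k * F by rewrite leq_mul2r kk orbT.
have a2 : k * kap <= k * k by rewrite leq_mul2l kk orbT.
have a3 : k * kap * F <= k * k * F by rewrite leq_mul2r a2 orbT.
have a4 : k * 1 <= k * F by rewrite leq_mul2l; apply/orP; right; lia.
have a5 : k * k * 1 <= k * k * F by rewrite leq_mul2l; apply/orP; right; lia.
move: kk F1 a1 a2 a3 a4 a5; clear; lia.
Qed.

Lemma exists_hard_strip_sample kap : 4 <= kap -> let k := 2 ^ kap in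
  exists q M N H R m (x : {ffun 'I_R * 'I_m -> 'I_q * 'I_M}),
  [/\ 2 ^ (2 ^ (4 * k)) <= R * m, R * m <= 2 ^ (2 ^ (5 * k)),
   8 * collisions ('I_q * 'I_M)%type 'I_R m x <= R * m &
  forall (tau : nat) (hit : 'I_tau -> 'I_N * 'I_H -> bool) (z : 'I_tau -> option ('I_q * 'I_M)),
    (forall t l l' y, l != l' -> hit t l -> hit t l' -> y \in strip_inc q M N H l ->
       y \in strip_inc q M N H l' -> z t = Some y) ->
    (forall t l1 l2 l3, hit t l1 -> hit t l2 -> hit t l3 ->
       l1 != l2 -> l1 != l3 -> l2 != l3 -> (l1, l2, l3) \in concurrent N H) ->
    4 * tau <= R * m ->
  exists l, (exists2 A : {set 'I_R * 'I_m}, #|A| = k &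
      conf ('I_q * 'I_M)%type ('I_N * 'I_H)%type 'I_R (strip_inc q M N H) m x A l) /\
    forall t, ~~ hit t l].
Proof.
move=> kap4 k.
have kk : kap < k by rewrite ltn_expl.
have k16 : 16 <= k by rewrite (_ : 16 = 2 ^ 4) // leq_exp2l.
have := exponent_budget kap k (4 ^ k) (ltnW kk) (quadratic_le_pow4 k k16).
have eE : 2 ^ (4 * k) = 4 ^ k * 4 ^ k.
  by rewrite -expnMn -[4 * 4]/(2 ^ 4) -expnM.
rewrite -eE.
(* c 4^j satisfies the recursion because 3 c 4^j + c <= 4 c 4^j. *)
pose c := 66 + 5 * kap; rewrite -/c; pose b j := c * 4 ^ j; pose B := c * 4 ^ k; rewrite -/B.
pose Qe := 44 + 3 * kap + 2 * B; pose re := 3 + kap + Qe.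
have reE : 47 + 4 * kap + 2 * B = re by rewrite /re /Qe; lia.
rewrite reE; pose s := k * (re + 1) + 1; rewrite -/s.
pose e := 2 ^ (4 * k); rewrite -/e => bud.
pose h := k * e + s - e; pose nu := h + kap + 36; pose mu := nu - e - re.
have ke : 16 * e <= k * e by rewrite leq_mul2r k16 orbT.
have hE : h + e = k * e + s by rewrite /h; lia.
have sre : re <= s by rewrite /s; move: k16; clear; nia.
have bB j : j <= k -> b j <= B by move=> jk; rewrite /b /B leq_mul2l leq_exp2l // jk orbT.
have muE : re + mu + e = nu by rewrite /mu /nu; lia.
have cB : c <= B by rewrite /B leq_pmulr // expn_gt0.
(* The argument kap + 4 k + 1 is the exponent of 2 k e, which exceeds h. *)
have [||||||||||||||| x [xc xh]] := @hard_sample_from_exponents kap k h nu e re mu s B Qe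
  (kap + 4 * k + 1) 16 b => //.
- by move=> j _; rewrite /b expnS /c; have := expn_gt0 4 j; move: (4 ^ j) => w /= w0; clear -w0; nia.
- have : k * 1 <= k * re by rewrite leq_mul2l; lia.
  have : 1 * re <= k * re by rewrite leq_mul2r; lia.
  rewrite /s -reE; move: k16; clear; lia.
- move: bud kk; clear; lia.
- apply: (@leq_trans (2 * (k * e))); first by move: hE bud ke; clear; lia.
  by rewrite /e -expnD -expnS leq_exp2l //; clear; lia.
- move: muE hE bud ke sre kk k16; rewrite -reE /Qe; clear; lia.
have cI : #|{: 'I_(2 ^ re) * 'I_(2 ^ mu)}| = 2 ^ re * 2 ^ mu by rewrite card_prod !card_ord.
rewrite cI in xc xh.
exists (2 ^ (kap + 18)), (2 ^ nu), (2 ^ nu - 2 ^ (kap + 18) * 2 ^ h), (2 ^ h), (2 ^ re), (2 ^ mu), x.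
split => //.
- by rewrite -expnD leq_exp2l // -/e; move: muE hE bud ke; rewrite /nu; clear; lia.
- rewrite -expnD leq_exp2l //; apply: (@leq_trans (k * e)).
    by move: muE hE bud ke; rewrite /nu; clear; lia.
  by rewrite /e -expnD leq_exp2l //; move: kk; clear; lia.
Qed.

End Instance.

(** * Transfer to the real plane and conclusion *)

Open Scope R_scope.

Lemma INR_expn a b : INR (a ^ b)%N = INR a ^ b.
Proof. by elim: b => [|b IH]; rewrite ?expn0 // expnS mult_INR IH. Qed.

Lemma INR_2X a : INR (2 ^ a)%N = 2 ^ a.
Proof. by rewrite INR_expn -[2 in RHS](INR_IZR_INZ 2). Qed.

Lemma leq_INR (a b : nat) : (a <= b)%N -> INR a <= INR b.
Proof. by move=> h; apply: le_INR; lia. Qed.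

Lemma length_filter_map (T U : Type) (f : T -> U) (p : U -> bool) (s : seq T) :
  length (List.filter p (List.map f s)) = count (fun y => p (f y)) s.
Proof. by elim: s => //= y s IH; case: (p (f y)); rewrite /= IH. Qed.

Lemma uniq_NoDup (T : eqType) (s : seq T) : uniq s -> NoDup s.
Proof.
elim: s => [|y s IH] /=; first by constructor.
case/andP=> ys us; constructor; last exact: IH.
move=> h; case/negP: ys; elim: s h {IH us} => //= z s IH [->|/IH h].
  by rewrite inE eqxx.
by rewrite inE h orbT.
Qed.

Lemma card_le_image_collisions (V P : finType) (m : nat) (x : {ffun P * 'I_m -> V}) :
  (#|{: P * 'I_m}| <= #|x @: setT| + collisions V P m x)%N.
Proof.
pose Co := [set u | [exists u', (u != u') && (x u == x u')]].
have cCo : (#|Co| <= collisions V P m x)%N.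
  rewrite -sum1_card big_mkcond; apply: leq_sum => u _; rewrite inE.
  by case: ifP => // /existsP[u' hu]; rewrite (bigD1 u') //= hu.
rewrite -(cardsC Co) addnC; apply: leq_add => //.
rewrite -(@card_in_imset _ _ x) => [|u w]; first exact/subset_leq_card/imsetS/subsetT.
rewrite !inE => /existsP h _ e; apply/eqP/negPn/negP => ne; apply: h.
by exists w; rewrite ne e eqxx.
Qed.

Lemma on_line_decP l p : reflect (on_line l p) (on_line_dec l p).
Proof. by rewrite /on_line_dec; case: Req_EM_T => h; constructor. Qed.

Lemma plane_line_nondegenerate (b : R) : ~ (- b = 0 /\ 1 = 0).
Proof. by case=> _; apply: R1_neq_R0. Qed.

Section Plane.
Variables (q M N H : nat).
Notation V := ('I_q * 'I_M)%type.
Notation L := ('I_N * 'I_H)%type.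

Definition plane_point (y : V) : point := (INR y.1, INR y.2).

Definition plane_line (l : L) : line :=
  mkLine (- INR l.2) 1 (INR l.1) (plane_line_nondegenerate (INR l.2)).

Lemma plane_point_inj : injective plane_point.
Proof.
move=> [s v] [s' v'] [/INR_eq e1 /INR_eq e2].
by congr pair; apply: val_inj.
Qed.

Lemma strip_incE (l : L) (y : V) :
  (y \in strip_inc q M N H l) <-> INR y.2 = INR l.1 + INR y.1 * INR l.2.
Proof.
rewrite inE -mult_INR -plus_INR; split => [/eqP -> //|/INR_eq e]; exact/eqP.
Qed.

Lemma plane_incidence (l : L) (y : V) :
  on_line_dec (plane_line l) (plane_point y) = (y \in strip_inc q M N H l).
Proof.
apply/on_line_decP/idP; rewrite /on_line /=.
  by move/line_equation => e; apply/strip_incE.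
by move/strip_incE => e; apply/line_equation.
Qed.

Lemma plane_lines_meet (l l' : L) (y : V) (t : point) : l != l' ->
  on_line (plane_line l) t -> on_line (plane_line l') t ->
  y \in strip_inc q M N H l -> y \in strip_inc q M N H l' -> plane_point y = t.
Proof.
move=> ne h h' /strip_incE e /strip_incE e'; case: t h h' => X Y; rewrite /on_line /= => h h'.
have nb : INR l.2 <> INR l'.2.
  move=> eb; case/eqP: ne; rewrite -eb in e'; have ea := parallel_lines_equal _ _ _ _ _ e e'.
  case: l l' eb ea {h h' e e'} => [a b] [a' b'] /= /INR_eq eb /INR_eq ea.
  by congr pair; apply: val_inj.
by have [e1 e2] := lines_meet_once _ _ _ _ _ _ _ _ h h' e e' nb; rewrite /plane_point e1 e2.
Qed.

Lemma plane_lines_slopes (l l' : L) (t : point) : l != l' ->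
  on_line (plane_line l) t -> on_line (plane_line l') t -> l.2 != l'.2.
Proof.
move=> ne; rewrite /on_line /= => h h'; apply: contra ne => /eqP eb.
rewrite -eb h in h'; case: l l' eb h' {h} => [a b] [a' b'] /= -> /INR_eq ea.
by apply/eqP; congr pair; apply: val_inj.
Qed.

Lemma plane_lines_concurrent (l1 l2 l3 : L) (t : point) :
  on_line (plane_line l1) t -> on_line (plane_line l2) t -> on_line (plane_line l3) t ->
  l1 != l2 -> l1 != l3 -> (l1, l2, l3) \in concurrent N H.
Proof.
move=> h1 h2 h3 n12 n13.
have s2 : l2.2 != l1.2 by rewrite eq_sym; exact: plane_lines_slopes n12 h1 h2.
have s3 : l3.2 != l1.2 by rewrite eq_sym; exact: plane_lines_slopes n13 h1 h3.
rewrite inE /= s2 s3 /=; apply/eqP.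
have := concurrent_identity _ _ _ _ _ _ _ _ h1 h2 h3.
rewrite -!mult_INR -!plus_INR => /INR_eq.
move: (nat_of_ord l1.1) (nat_of_ord l1.2) (nat_of_ord l2.1) (nat_of_ord l2.2)
  (nat_of_ord l3.1) (nat_of_ord l3.2); clear => a1 b1 a2 b2 a3 b3 e; lia.
Qed.

End Plane.

Theorem theorem2p3 :
  exists c : R, 0 < c /\
  forall eps0 : R, 0 < eps0 -> eps0 < c ->
  exists (epss : R) (S : list point),
    0 < epss /\ epss < eps0 /\ NoDup S /\ S <> nil /\
    forall T : list point, NoDup T -> weak_eps_net epss S T ->
      INR (length T) >=
        / (10 * epss) * Rpower (log2 (log2 (/ epss))) (1 / 10).
Proof.
exists 1; split; first exact: Rlt_0_1.
move=> eps0 eps00 _.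
have [kap0 hkap0] : exists a : nat, / eps0 < INR a.
  exact: INR_unbounded.
(* The 4 ensures k >= 16, and kap0 ensures k > 1/eps0. *)
pose kap := maxn 4 kap0; pose k := (2 ^ kap)%N.
have kap4 : (4 <= kap)%N by rewrite leq_maxl.
have kk : (kap < k)%N by rewrite ltn_expl.
have k16 : (16 <= k)%N by rewrite (_ : 16%N = (2 ^ 4)%N) // leq_exp2l.
have hk : / eps0 < INR k.
  apply: Rlt_le_trans hkap0 _; apply: leq_INR; apply: leq_trans (ltnW kk); exact: leq_maxr.
have [q [M [N [H [R [m [x [lo hi col hard]]]]]]]] := exists_hard_strip_sample kap kap4.
pose Im := x @: [set: 'I_R * 'I_m].
pose S := List.map (plane_point q M) (enum Im).
pose n := (R * m)%N.
have cI : #|{: 'I_R * 'I_m}| = n by rewrite card_prod !card_ord.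
have szS : length S = #|Im| by rewrite /S length_map cardE.
have sgn : (#|Im| <= n)%N by rewrite -cI -cardsT leq_imset_card.
(* S is the image of the sample; at most n/8 collisions cost it at most an eighth of n. *)
have nsg : (7 * n <= 8 * #|Im|)%N.
  have h : (n <= #|Im| + collisions _ _ _ x)%N by rewrite -cI card_le_image_collisions.
  have : (8 * n <= 8 * #|Im| + n)%N.
    by apply: leq_trans (leq_mul (leqnn 8) h) _; rewrite mulnDr leq_add2l.
  by move: (n) #|Im|; clear; lia.
have nk : (2 * (k * k) <= n)%N.
  apply: leq_trans lo; apply: leq_trans (ltnW (ltn_expl _ _)) => //; rewrite -/k.
  apply: (@leq_trans (2 ^ (k + k).+1)); last by rewrite leq_exp2l //; move: k16; clear; lia.
  by rewrite expnS expnD leq_mul2l leq_mul // ltnW // ltn_expl.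
have sgk : (k * k <= #|Im|)%N by move: nsg nk; clear; lia.
have k0 : 0 < INR k by apply: lt_0_INR; lia.
have sg0 : 0 < INR #|Im|.
  by apply: lt_0_INR; move: sgk k16; clear; nia.
(* With this ratio the lines a net must meet are those with at least k points of S; k^2 <= |S| makes
   it at most 1/k < eps0. *)
exists (INR k / INR #|Im|), S; split; first by apply: Rdiv_lt_0_compat.
split.
  by apply: net_ratio_lt => //; rewrite -mult_INR; apply: leq_INR.
split.
  apply: Injective_map_NoDup; first by move=> y y'; exact: plane_point_inj.
  exact/uniq_NoDup/enum_uniq.
split.
  move=> S0; move: szS; rewrite S0 /= => z; move: sg0; rewrite -z /=; exact: Rlt_irrefl.
move=> T _ net; apply: Rnot_lt_ge => few.
pose tau := length T.
have tn : (4 * tau <= n)%N.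
  apply: (leq_trans _ sgn); apply/ssrnat.leP; apply: INR_lt_quarter; apply: Rlt_le_trans few _.
  apply: (net_bound_le _ _ (2 ^ (5 * k)) (5 * k)).
  - by rewrite -[16](INR_IZR_INZ 16); apply: leq_INR.
  - rewrite -[4](INR_IZR_INZ 4) -mult_INR; apply: leq_INR; apply: leq_trans sgk.
    by rewrite multE leq_mul2r; apply/orP; right; move: k16; clear; lia.
  - by rewrite -INR_2X; apply: leq_INR; exact: leq_trans sgn hi.
  - by rewrite -INR_2X; apply: leq_INR.
  - by rewrite -[5](INR_IZR_INZ 5) -mult_INR; apply: leq_INR.
pose pt (i : 'I_tau) : point := List.nth i T (0, 0).
pose hit (i : 'I_tau) (l : 'I_N * 'I_H) := on_line_dec (plane_line N H l) (pt i).
pose peq (p p' : point) : bool := (if Req_EM_T p.1 p'.1 then true else false) &&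
  (if Req_EM_T p.2 p'.2 then true else false).
have peqP p p' : reflect (p = p') (peq p p').
  rewrite /peq; case: Req_EM_T => /= h1; last by constructor => e; case: h1; rewrite e.
  case: Req_EM_T => h2; constructor; last by move=> e; case: h2; rewrite e.
  by case: p p' h1 h2 => [a b] [a' b'] /= -> ->.
pose z (i : 'I_tau) : option ('I_q * 'I_M) := [pick y | peq (plane_point q M y) (pt i)].
have [| |//|l [[A cA /and3P[_ /eqP cxA sA]] nohit]] := hard tau hit z.
- move=> i l l' y ne /on_line_decP h /on_line_decP h' yl yl'.
  have e := plane_lines_meet _ _ _ _ _ _ _ _ ne h h' yl yl'.
  rewrite /z; case: pickP => [y' /peqP e'|/(_ y)]; last by move/peqP.
  by congr Some; apply: (plane_point_inj q M); rewrite e e'.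
- move=> i l1 l2 l3 /on_line_decP h1 /on_line_decP h2 /on_line_decP h3 n12 n13 _.
  exact: plane_lines_concurrent h1 h2 h3 n12 n13.
(* The missed line carries the k distinct points of x @: A, so the net property applies to it and
   contradicts [nohit]. *)
have [] := net (plane_line N H l).
  rewrite szS /Rdiv Rmult_assoc Rinv_l ?Rmult_1_r; last by move=> e; rewrite e in sg0; apply: Rlt_irrefl sg0.
  apply: Rle_ge; apply: leq_INR; rewrite /count_on_line length_filter_map.
  have kxA : #|x @: A| = k by rewrite cxA cA.
  rewrite (eq_count (fun y => plane_incidence _ _ _ _ l y)) -kxA -size_filter cardE.
  apply: uniq_leq_size; first exact: enum_uniq.
  move=> y yA; rewrite mem_enum in yA; rewrite mem_filter mem_enum (subsetP sA) //=.
  by case/imsetP: yA => u _ ->; rewrite imset_f // inE.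
move=> t [tT tl]; have [i [iT e]] := In_nth T t (0, 0) tT.
have itau : (i < tau)%N by rewrite /tau; lia.
have := nohit (Ordinal itau); rewrite /hit /pt /= e => /on_line_decP; exact.
Qed.
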